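(* For any $k,d\in\mathbb{N}$, any sufficiently small $\alpha,\varepsilon>0$ and all $m\in\mathbb{N}$, \[ n_m^{\mathrm{PD}(k,d;\alpha)}(\varepsilon,\delta=0)=\tilde{\Theta}\left(\frac{kd}{\varepsilon}+\frac{kd}{\alpha\varepsilon\sqrt{m}}+\frac{kd}{\alpha^2 m}\right). \]
   Context: User-level DP: there are $n$ users each holding $m$ examples from a domain $\mathcal{Z}$; two inputs in $\mathcal{Z}^{nm}$ are user-level neighbors if they differ only in one user's $m$ examples; an algorithm with finite output set is $(\varepsilon,\delta)$-user-level DP if $\Pr[\mathbf{A}(\mathbf{x})\in S]\le e^\varepsilon\Pr[\mathbf{A}(\mathbf{x}')\in S]+\delta$ for all neighbors and all output sets $S$. For a task with correct-answer sets $\Psi(\mathcal{D})$, $n_m(\varepsilon,\delta)$ is the smallest $n$ such that some $(\varepsilon,\delta)$-user-level DP algorithm, given $nm$ i.i.d. samples from $\mathcal{D}$ grouped into $n$ users, outputs an element of $\Psi(\mathcal{D})$ with probability at least $2/3$ for every valid $\mathcal{D}$. The task $\mathrm{PD}(k,d;\alpha)$: $\mathcal{Z}=[k]^d$, the valid distributions are product distributions on $[k]^d$, and a correct output is a distribution $\mathcal{Q}$ with $d_{\mathrm{TV}}(\mathcal{Q},\mathcal{D})\le\alpha$. $\tilde{\Theta}$ hides factors polylogarithmic in the relevant parameters (including $1/\alpha$ and $d$).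
   Formalization: The claim is proved for k ≥ 2 (and d, m ≥ 1): for k = 1 the domain [k]^d is a single point, no users are needed, so n_m = 0 and the stated lower bound fails. *)

(* Defs.v *)
From HB Require Import structures.
From mathcomp Require Import all_boot all_order all_algebra.
From mathcomp Require Import all_classical all_reals all_analysis.

Set Implicit Arguments.
Unset Strict Implicit.
Unset Printing Implicit Defensive.

Import Order.TTheory GRing.Theory Num.Theory.

Local Open Scope classical_set_scope.
Local Open Scope ring_scope.

Record fdist (R : realType) (T : finType) := FDist {
  pmf :> {ffun T -> R} ;
  pmf_ge0 : [forall t, 0 <= pmf t] ;
  pmf_sum1 : \sum_t pmf t == 1 }.

Definition Prob (R : realType) (T : finType) (P : fdist R T) (S : {set T}) : R :=
  \sum_(t in S) P t.

Definition dTV (R : realType) (T : finType) (P Q : fdist R T) : R :=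
  2^-1 * \sum_t `|P t - Q t|.

Record task (R : realType) := Task {
  example : finType ;
  answer : Type ;
  valid : set (fdist R example) ;
  correct : fdist R example -> set answer }.

Definition database (Z : finType) (n m : nat) : finType :=
  {ffun 'I_n -> {ffun 'I_m -> Z}}.

Definition user_neighbors (Z : finType) (n m : nat) (x x' : database Z n m) : Prop :=
  exists i : 'I_n, forall j : 'I_n, j != i -> x j = x' j.

Definition iid_weight (R : realType) (Z : finType) (D : fdist R Z) (n m : nat)
    (x : database Z n m) : R :=
  \prod_(i < n) \prod_(j < m) D (x i j).

(* The finite output set is the image of [out]; outputs are referred to by
   their index in 'I_size_out. *)
Record algorithm (R : realType) (Z : finType) (O : Type) (n m : nat) := Algorithm {
  size_out : nat ;
  out : 'I_size_out -> O ;
  out_inj : injective out ;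
  run : database Z n m -> fdist R 'I_size_out }.

Definition user_DP (R : realType) (Z : finType) (O : Type) (n m : nat)
    (A : algorithm R Z O n m) (eps delta : R) : Prop :=
  forall x x' : database Z n m, user_neighbors x x' ->
  forall S : {set 'I_(size_out A)},
    Prob (run A x) S <= expR eps * Prob (run A x') S + delta.

Definition success (R : realType) (Z : finType) (O : Type) (n m : nat)
    (A : algorithm R Z O n m) (D : fdist R Z) (good : set O) : R :=
  \sum_(x : database Z n m)
    iid_weight D x * Prob (run A x) [set o | `[< good (out o) >]]%SET.

Definition user_solvable (R : realType) (T : task R) (m : nat) (eps delta : R)
    (n : nat) : Prop :=
  exists A : algorithm R (example T) (answer T) n m,
    user_DP A eps delta /\
    forall D, valid D -> 2 / 3 <= success A D (correct D).

(* [is_user_complexity T m eps delta n] reads n = n_m^T(eps, delta). *)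
Definition is_user_complexity (R : realType) (T : task R) (m : nat)
    (eps delta : R) (n : nat) : Prop :=
  user_solvable T m eps delta n /\
  forall n', user_solvable T m eps delta n' -> (n <= n')%N.

Definition is_product (R : realType) (k d : nat)
    (D : fdist R {ffun 'I_d -> 'I_k}) : Prop :=
  exists P : 'I_d -> fdist R 'I_k,
    forall z : {ffun 'I_d -> 'I_k}, D z = \prod_(i < d) P i (z i).

(* Improper learning: the answer need not be a product distribution. *)
Definition PD (R : realType) (k d : nat) (alpha : R) : task R :=
  @Task R {ffun 'I_d -> 'I_k} (fdist R {ffun 'I_d -> 'I_k})
    [set D | is_product D]
    (fun D => [set Q | dTV Q D <= alpha]).

(* x = Theta~(y), the hidden factor being C * (1 + ln q) ^+ p on both sides. *)
Definition theta_tilde_with (R : realType) (C : R) (p : nat) (q x y : R) : Prop :=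
  y / (C * (1 + ln q) ^+ p) <= x <= C * (1 + ln q) ^+ p * y.

(* Main.v *)
(** Upper bound.  Treat the [m] examples of a user as one draw from [D^m] and
select a hypothesis from a finite cover of the product distributions of size
[exp(O~(kd))].  Two hypotheses at L1 distance more than [alpha] are told apart by
a clipped linear statistic of the user's examples: clipping at
[sqrt m * polylog] costs only a logarithm, and the resulting [-1,1]-valued test has
bias [min(1, alpha sqrt m) / polylog].  The exponential mechanism, scoring a
hypothesis by its worst test, then needs [log |cover| / (eps * bias)] users for
privacy and [log |cover| / bias^2] users for concentration.

Lower bound.  Let each coordinate be a default symbol with odds such that a
typical example has at most one non-default coordinate.  The family then looks
like arbitrary distributions on [d(k-1)] cells, each cell being perturbed by a
factor [1 + eta] or not.  Distributions correct for the same output agree on all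
but a small fraction of the cells, so averaging over the [2^(d(k-1))] members
gives one member [P] whose correct outputs have probability at most
[(3/5)^(d(k-1))] under the unperturbed [Q].  Replacing [Q] by [P] one user at a
time multiplies the probability of an event by at most
[1 + TV(P^m, Q^m) (e^eps - 1)], and the chi-square divergence of [P^(nm)] from
[Q^(nm)] is at most [exp(n m eta^2) - 1]; [eta = 1] and [eta] of order [alpha]
give the three terms. *)

Require Import Defs.
From HB Require Import structures.
From mathcomp Require Import all_boot all_order all_algebra.
From mathcomp Require Import all_classical all_reals all_analysis.
From mathcomp Require Import ring lra.

Set Implicit Arguments.
Unset Strict Implicit.
Unset Printing Implicit Defensive.

Import Order.TTheory GRing.Theory Num.Theory.
Local Open Scope ring_scope.

(** * Expectations under product weights *)

Definition ffcons (T : finType) (n : nat) (t : T) (y : {ffun 'I_n -> T}) :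
    {ffun 'I_n.+1 -> T} :=
  [ffun i => if unlift ord0 i is Some j then y j else t].

Lemma ffcons0 (T : finType) (n : nat) (t : T) (y : {ffun 'I_n -> T}) :
  ffcons t y ord0 = t.
Proof. by rewrite ffunE unlift_none. Qed.

Lemma ffconsS (T : finType) (n : nat) (t : T) (y : {ffun 'I_n -> T}) j :
  ffcons t y (lift ord0 j) = y j.
Proof. by rewrite ffunE liftK. Qed.

Lemma sum_ffcons (R : realType) (T : finType) (n : nat)
    (F : {ffun 'I_n.+1 -> T} -> R) :
  \sum_x F x = \sum_t \sum_y F (ffcons t y).
Proof.
rewrite pair_big /= (reindex (fun p : T * {ffun 'I_n -> T} => ffcons p.1 p.2)) //=.
exists (fun x => (x ord0, [ffun j => x (lift ord0 j)])) => [[t y] _|x _] /=.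
  congr pair; first exact: ffcons0.
  by apply/ffunP => j; rewrite ffunE ffconsS.
apply/ffunP => i; case: (unliftP ord0 i) => [j ->|->].
  by rewrite ffconsS ffunE.
by rewrite ffcons0.
Qed.

(** [P] is any weight function, so that exponentially tilted weights and squared likelihood ratios
    can be summed with [sum_pw]. The nested [pw (pw D)] is the weight of a database under i.i.d.
    sampling. *)
Definition pw (R : realType) (T : finType) (n : nat) (P : T -> R)
    (x : {ffun 'I_n -> T}) : R := \prod_i P (x i).

Lemma pw_ge0 (R : realType) (T : finType) (n : nat) (P : T -> R) x :
  (forall t, 0 <= P t) -> 0 <= @pw R T n P x.
Proof. by move=> P0; apply: prodr_ge0. Qed.

Lemma sum_pw (R : realType) (T : finType) (n : nat) (P : T -> R) :
  \sum_x @pw R T n P x = (\sum_t P t) ^+ n.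
Proof.
by rewrite /pw -(bigA_distr_bigA (fun=> P)) prodr_const card_ord.
Qed.

Definition Eprod (R : realType) (T : finType) (n : nat) (P : T -> R)
    (g : {ffun 'I_n -> T} -> R) : R :=
  \sum_x pw P x * g x.

Lemma EprodS (R : realType) (T : finType) (n : nat) (P : T -> R)
    (g : {ffun 'I_n.+1 -> T} -> R) :
  Eprod P g = \sum_t P t * Eprod P (fun y => g (ffcons t y)).
Proof.
rewrite /Eprod sum_ffcons; apply: eq_bigr => t _; rewrite mulr_sumr.
apply: eq_bigr => y _; rewrite /pw big_ord_recl ffcons0 mulrA; congr (_ * _ * _).
by apply: eq_bigr => i _; rewrite ffconsS.
Qed.

Lemma Eprod_le (R : realType) (T : finType) (n : nat) (P : T -> R)
    (f g : {ffun 'I_n -> T} -> R) :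
  (forall t, 0 <= P t) -> (forall x, f x <= g x) -> Eprod P f <= Eprod P g.
Proof.
move=> P0 fg; apply: ler_sum => x _; apply: ler_wpM2l => //.
exact: pw_ge0.
Qed.

Lemma Eprod_ge0 (R : realType) (T : finType) (n : nat) (P : T -> R)
    (f : {ffun 'I_n -> T} -> R) :
  (forall t, 0 <= P t) -> (forall x, 0 <= f x) -> 0 <= Eprod P f.
Proof.
move=> P0 f0; apply: sumr_ge0 => x _; apply: mulr_ge0 => //.
exact: pw_ge0.
Qed.

Lemma EprodD (R : realType) (T : finType) (n : nat) (P : T -> R)
    (f g : {ffun 'I_n -> T} -> R) :
  Eprod P (fun x => f x + g x) = Eprod P f + Eprod P g.
Proof. by rewrite /Eprod -big_split; apply: eq_bigr => x _; rewrite mulrDr. Qed.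

Lemma EprodZ (R : realType) (T : finType) (n : nat) (P : T -> R) (c : R)
    (f : {ffun 'I_n -> T} -> R) :
  Eprod P (fun x => c * f x) = c * Eprod P f.
Proof. by rewrite /Eprod mulr_sumr; apply: eq_bigr => x _; rewrite mulrCA. Qed.

Lemma Eprod_cst (R : realType) (T : finType) (n : nat) (P : T -> R) (c : R) :
  \sum_t P t = 1 -> Eprod P (fun _ : {ffun 'I_n -> T} => c) = c.
Proof.
move=> P1; rewrite /Eprod -mulr_suml.
by rewrite sum_pw P1 expr1n mul1r.
Qed.

Lemma Eprod_exchange (R : realType) (T I : finType) (n : nat) (P : T -> R)
    (A : pred I) (f : I -> {ffun 'I_n -> T} -> R) :
  Eprod P (fun x => \sum_(i | A i) f i x) = \sum_(i | A i) Eprod P (f i).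
Proof.
rewrite /Eprod exchange_big /=; apply: eq_bigr => x _.
by rewrite mulr_sumr.
Qed.

Lemma Eprod_sum (R : realType) (T : finType) (n : nat) (P : T -> R) (h : T -> R) :
  \sum_t P t = 1 ->
  Eprod P (fun x : {ffun 'I_n -> T} => \sum_i h (x i)) = n%:R * \sum_t P t * h t.
Proof.
move=> P1; elim: n => [|n IH].
  rewrite mul0r /Eprod big1 // => x _; by rewrite big_ord0 mulr0.
rewrite EprodS.
under eq_bigr => t _.
  rewrite (_ : Eprod _ _ = h t + n%:R * \sum_t P t * h t); last first.
    rewrite -IH -[X in X + _](Eprod_cst n (h t) P1) -EprodD.
    apply: eq_bigr => y _; rewrite big_ord_recl ffcons0; congr (_ * (_ + _)).
    by apply: eq_bigr => i _; rewrite ffconsS.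
  over.
rewrite /=; under eq_bigr => t _ do rewrite mulrDr.
by rewrite big_split /= -mulr_suml P1 mul1r mulrSr mulrDl mul1r addrC.
Qed.

Lemma Eprod_expR (R : realType) (T : finType) (n : nat) (P : T -> R) (h : T -> R) :
  Eprod P (fun x : {ffun 'I_n -> T} => expR (\sum_i h (x i))) =
  (\sum_t P t * expR (h t)) ^+ n.
Proof.
rewrite -(sum_pw n (fun t => P t * expR (h t))); apply: eq_bigr => x _.
by rewrite /pw big_split /= expR_sum.
Qed.

(** From e^(-y) >= 1 - y one gets (1 - y) e^y <= 1, while (1 - y)(1 + y + 2 y^2) = 1 + y^2 (1 - 2 y)
    >= 1. *)
Lemma expR_quad (R : realType) (y : R) : y <= 1 / 2 -> expR y <= 1 + y + 2 * y ^+ 2.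
Proof.
move=> y2; have h : 1 - y <= expR (- y) := expR_ge1Dx (- y).
have e0 := expR_gt0 y.
have : (1 - y) * expR y <= 1.
  have e1 : expR (- y) * expR y = 1 by rewrite -expRD addNr expR0.
  by rewrite -[leRHS]e1 ler_pM2r.
have : 1 <= (1 - y) * (1 + y + 2 * y ^+ 2) by nra.
move=> h1 h2; have : (1 - y) * expR y <= (1 - y) * (1 + y + 2 * y ^+ 2) by lra.
by rewrite ler_pM2l //; lra.
Qed.

(** * Finite distributions and their products *)

Lemma normalize (R : realType) (T : finType) (w : T -> R) :
  (forall t, 0 <= w t) -> 0 < \sum_t w t ->
  exists P : fdist R T, forall t, P t = w t / \sum_u w u.
Proof.
move=> w0 s0.
have h1 : [forall t, 0 <= [ffun t => w t / \sum_u w u] t].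
  by apply/forallP => t; rewrite ffunE divr_ge0 // ltW.
have h2 : \sum_t [ffun t => w t / \sum_u w u] t == 1.
  under eq_bigr => t _ do rewrite ffunE.
  by rewrite -mulr_suml divff // gt_eqF.
by exists (FDist h1 h2) => t; rewrite ffunE.
Qed.

Lemma fdist_ge0 (R : realType) (T : finType) (P : fdist R T) t : 0 <= P t.
Proof. by have /forallP/(_ t) := Defs.pmf_ge0 P. Qed.

Lemma fdist_sum (R : realType) (T : finType) (P : fdist R T) : \sum_t P t = 1.
Proof. exact/eqP/Defs.pmf_sum1. Qed.

Lemma prod_fdist (R : realType) (d : nat) (T : finType) (P : 'I_d -> fdist R T) :
  exists D : fdist R {ffun 'I_d -> T}, forall z, D z = \prod_i P i (z i).
Proof.
have s1 : \sum_(z : {ffun 'I_d -> T}) \prod_i P i (z i) = 1.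
  rewrite -(bigA_distr_bigA (fun i => P i : T -> R)) big1 // => i _.
  exact: fdist_sum.
have [||D hD] := @normalize R _ (fun z : {ffun 'I_d -> T} => \prod_i P i (z i)).
- by move=> z; apply: prodr_ge0 => i _; exact: fdist_ge0.
- by rewrite s1.
- by exists D => z; rewrite hD s1 divr1.
Qed.

Lemma Prob_ge0 (R : realType) (T : finType) (P : fdist R T) S : 0 <= Prob P S.
Proof. by apply: sumr_ge0 => t _; exact: fdist_ge0. Qed.

Lemma Prob_le1 (R : realType) (T : finType) (P : fdist R T) S : Prob P S <= 1.
Proof.
rewrite -(fdist_sum P) [leRHS](bigID (mem S)) /= lerDl.
by apply: sumr_ge0 => t _; exact: fdist_ge0.
Qed.

Lemma successE (R : realType) (Z : finType) (O : Type) (n m : nat)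
    (A : algorithm R Z O n m) (D : fdist R Z) (good : set O) :
  success A D good =
  Eprod (pw (D : Z -> R)) (fun x => Prob (run A x) [set o | `[< good (out o) >]]%SET).
Proof. by []. Qed.

(** * Testing two distributions with the examples of one user *)

(** [expR_quad] is averaged term by term; since [l] is nonnegative, an upper bound on the mean of
    [h] suffices. *)
Lemma exp_moment (R : realType) (T : finType) (P : T -> R) (h : T -> R) (c b l : R) :
  (forall t, 0 <= P t) -> \sum_t P t = 1 ->
  (forall t, `|h t| <= c) -> \sum_t P t * h t <= b -> 0 <= l -> l * c <= 1 / 2 ->
  \sum_t P t * expR (l * h t) <= expR (l * b + 2 * (l * c) ^+ 2).
Proof.
move=> P0 P1 hc hb l0 lc; apply: le_trans (expR_ge1Dx _).
apply: (@le_trans _ _ (\sum_t (P t + l * (P t * h t) + P t * (2 * (l * c) ^+ 2)))).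
  apply: ler_sum => t _.
  have ht := hc t.
  have hl : `|l * h t| <= l * c by rewrite normrM (ger0_norm l0) ler_wpM2l.
  have hle : l * h t <= 1 / 2 by apply: le_trans lc; apply: le_trans hl; exact: ler_norm.
  have sq : (l * h t) ^+ 2 <= (l * c) ^+ 2.
    by rewrite -(real_normK (num_real (l * h t))) lerXn2r // ?nnegrE //; apply: le_trans hl.
  have q := expR_quad hle.
  rewrite [X in _ <= X](_ : _ = P t * (1 + l * h t + 2 * (l * c) ^+ 2)); last by ring.
  by apply: ler_wpM2l => //; lra.
rewrite !big_split /= -mulr_sumr -mulr_suml P1 mul1r addrA !lerD //.
by rewrite ler_wpM2l.
Qed.

(** Chernoff's method with parameter b/8: the exponent is n b^2 (1/16 - 1/8 + 1/32) = - n b^2 /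
    32. *)
Lemma tail_bound (R : realType) (T : finType) (n : nat) (P : T -> R) (phi : T -> R) (b : R) :
  (forall t, 0 <= P t) -> \sum_t P t = 1 ->
  (forall t, `|phi t| <= 1) -> b <= \sum_t P t * phi t -> 0 < b <= 1 ->
  Eprod P (fun x : {ffun 'I_n -> T} => (\sum_i phi (x i) <= n%:R * b / 2)%R%:R)
    <= expR (- (n%:R * b ^+ 2 / 32)).
Proof.
move=> P0 P1 ph hb /andP[b0 b1].
have n0 : 0 <= n%:R :> R by [].
apply: (@le_trans _ _ (Eprod P (fun x : {ffun 'I_n -> T} =>
   expR (b / 8 * (n%:R * b / 2)) * expR (\sum_i (b / 8) * (- phi (x i)))))).
  apply: Eprod_le => [//|x].
  case: (lerP (\sum_i phi (x i)) _) => h /=; last by rewrite mulr_ge0 ?expR_ge0.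
  rewrite -expRD -mulr_sumr sumrN; apply: le_trans (expR_ge1Dx _).
  by rewrite lerDl -mulrDr mulr_ge0 //; lra.
rewrite EprodZ (Eprod_expR n P (fun t => b / 8 * - phi t)).
have mom : \sum_t P t * expR (b / 8 * - phi t) <= expR (b / 8 * - b + 2 * (b / 8 * 1) ^+ 2).
  apply: exp_moment => //; [by move=> t; rewrite normrN| | lra | lra].
  under eq_bigr => t _ do rewrite mulrN.
  by rewrite sumrN lerN2.
apply: (@le_trans _ _ (expR (b / 8 * (n%:R * b / 2)) *
   expR (b / 8 * - b + 2 * (b / 8 * 1) ^+ 2) ^+ n)).
  apply: ler_wpM2l; first exact: expR_ge0.
  rewrite lerXn2r // ?nnegrE ?expR_ge0 //.
  by apply: sumr_ge0 => t _; rewrite mulr_ge0 ?expR_ge0.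
rewrite -expRM_natl -expRD ler_expR; nra.
Qed.

Definition clip (R : realType) (T s : R) : R := Num.max (- T) (Num.min s T).

Lemma clipN (R : realType) (T s : R) : 0 <= T -> clip T (- s) = - clip T s.
Proof. by move=> T0; rewrite /clip /Order.max /Order.min; do 6?case: ifP; lra. Qed.

Lemma clip_norm (R : realType) (T s : R) : 0 <= T -> `|clip T s| <= T.
Proof.
by move=> T0; rewrite ler_norml /clip /Order.max /Order.min; do 3?case: ifP; lra.
Qed.

(* Follows from [y <= e^(l y) / l] applied to the overshoot [y = s - T]. *)
Lemma clip_lower (R : realType) (T s l : R) : 0 <= T -> 0 < l ->
  s - l^-1 * expR (l * (s - T)) <= clip T s.
Proof.
move=> T0 l0.
have e0 : 0 < l^-1 * expR (l * (s - T)) by rewrite mulr_gt0 ?invr_gt0 ?expR_gt0.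
have e1 : s - T <= l^-1 * expR (l * (s - T)).
  rewrite mulrC ler_pdivlMr // mulrC; have := expR_ge1Dx (l * (s - T)); lra.
by rewrite /clip /Order.max /Order.min; do 3?case: ifP; lra.
Qed.

(** Before clipping the sum has mean at least m a / 4. Its exponential moment at l = 1 / (4 sqrt m)
    is at most e, so by [clip_lower] clipping at T = 4 sqrt m tau costs at most 4 sqrt m e^(1 - tau)
    <= m a / 8. What remains is divided by T. *)
Lemma clip_mean (R : realType) (Z : finType) (m : nat) (D : fdist R Z) (h : Z -> R) (a tau : R) :
  (0 < m)%N -> 0 < a -> Num.sqrt m%:R * a <= 1 -> (forall z, `|h z| <= 2) ->
  a / 4 <= \sum_z D z * h z <= a -> 0 < tau ->
  32 * expR (1 - tau) <= Num.sqrt m%:R * a ->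
  Num.sqrt m%:R * a / (32 * tau) <=
  \sum_u pw D u *
    (clip (4 * Num.sqrt m%:R * tau) (\sum_(i < m) h (u i)) / (4 * Num.sqrt m%:R * tau)).
Proof.
move=> m0 a0 ma h2 /andP[lo hi] t0 tl.
set r := Num.sqrt m%:R in ma tl *.
have rr : r ^+ 2 = m%:R by rewrite sqr_sqrtr.
have r0 : 0 < r by rewrite sqrtr_gt0 ltr0n.
set T := 4 * r * tau.
have T0 : 0 < T by rewrite !mulr_gt0.
set l := (4 * r)^-1.
have l0 : 0 < l by rewrite invr_gt0 mulr_gt0.
have r1 : 1 <= r.
  rewrite -[leLHS](@sqrtr1 R) /r ler_sqrt ?ler1n //.
have mom : \sum_z D z * expR (l * h z) <= expR (l * a + 2 * (l * 2) ^+ 2).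
  apply: exp_moment => //; [exact: fdist_ge0|exact: fdist_sum|exact: ltW|].
  rewrite /l invfM; have : r^-1 <= 1 by rewrite invf_le1.
  lra.
have lr : l * r = 1 / 4 by rewrite /l; field; rewrite gt_eqF.
have big : Eprod D (fun u : {ffun 'I_m -> Z} => expR (\sum_i l * h (u i))) <= expR 1.
  rewrite (Eprod_expR m D (fun z => l * h z)).
  apply: (@le_trans _ _ (expR (l * a + 2 * (l * 2) ^+ 2) ^+ m)).
    rewrite lerXn2r // ?nnegrE ?expR_ge0 //.
    by apply: sumr_ge0 => t _; rewrite mulr_ge0 ?expR_ge0 ?fdist_ge0.
  rewrite -expRM_natl ler_expR -rr.
  have -> : r ^+ 2 * (l * a + 2 * (l * 2) ^+ 2) = (l * r) * (r * a) + 8 * (l * r) ^+ 2 by ring.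
  rewrite lr; lra.
have key : m%:R * a / 8 <= Eprod D (fun u : {ffun 'I_m -> Z} => clip T (\sum_i h (u i))).
  apply: (@le_trans _ _ (Eprod D (fun u : {ffun 'I_m -> Z} =>
     \sum_i h (u i) + (- (l^-1 * expR (- (l * T)))) * expR (\sum_i l * h (u i))))).
    rewrite EprodD EprodZ Eprod_sum ?fdist_sum //.
    have lT : l * T = tau by rewrite /l /T; field; rewrite gt_eqF.
    have li : l^-1 = 4 * r by rewrite /l invrK.
    rewrite lT li.
    have : expR (- tau) * Eprod D (fun u : {ffun 'I_m -> Z} => expR (\sum_i l * h (u i)))
        <= expR (1 - tau).
      rewrite addrC expRD; apply: ler_wpM2l => //; exact: expR_ge0.
    set X := expR _ * _ => hX.
    have : m%:R * (a / 4) <= m%:R * \sum_z D z * h z by rewrite ler_wpM2l.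
    have -> : - (4 * r * expR (- tau)) *
        Eprod D (fun u : {ffun 'I_m -> Z} => expR (\sum_i l * h (u i))) = - (4 * r * X).
      by rewrite /X; ring.
    have : r * X <= r * (r * a / 32) by rewrite ler_pM2l //; lra.
    have -> : r * (r * a / 32) = m%:R * a / 32 by rewrite -rr; ring.
    lra.
  apply: Eprod_le => [t|u]; first exact: fdist_ge0.
  apply: le_trans (clip_lower _ (ltW T0) l0).
  by rewrite -mulr_sumr mulNr -mulrA -expRD (addrC (- _)) -mulrBr.
have -> : \sum_(u : {ffun 'I_m -> Z}) pw D u * (clip T (\sum_i h (u i)) / T) =
   Eprod D (fun u : {ffun 'I_m -> Z} => clip T (\sum_i h (u i))) / T.
  by rewrite /Eprod mulr_suml; apply: eq_bigr => u _; rewrite mulrA.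
rewrite ler_pdivlMr //; apply: le_trans key.
by rewrite -rr /T le_eqVlt; apply/orP; left; apply/eqP; field; rewrite gt_eqF.
Qed.

(* The sign of [f - g] is rescaled so that its means under [f] and [g] differ by
   [min(alpha, 1 / sqrt m)], whatever their L1 distance: the sum over the [m] examples
   then stays at the scale of its standard deviation. *)
Lemma test_exists (R : realType) (Z : finType) (f g : fdist R Z) (m : nat) (alpha L : R) :
  (0 < m)%N -> 0 < alpha <= 1 -> alpha < \sum_z `|f z - g z| ->
  1 - ln alpha <= L ->
  exists phi : {ffun 'I_m -> Z} -> R,
    [/\ forall u, `|phi u| <= 1,
        forall D : fdist R Z, \sum_z `|D z - f z| <= alpha / 4 ->
          Num.min (Num.sqrt m%:R * alpha) 1 / (192 * L) <= \sum_u pw D u * phi u &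
        forall D : fdist R Z, \sum_z `|D z - g z| <= alpha / 4 ->
          \sum_u pw D u * phi u <= - (Num.min (Num.sqrt m%:R * alpha) 1 / (192 * L))].
Proof.
move=> m0 /andP[a0 a1] far hL.
have r0 : 0 < Num.sqrt m%:R :> R by rewrite sqrtr_gt0 ltr0n.
have r1 : 1 <= Num.sqrt m%:R :> R by rewrite -[leLHS](@sqrtr1 R) ler_sqrt ?ler1n.
set r := Num.sqrt m%:R in r0 r1 *.
set l1 := \sum_z `|f z - g z| in far.
set a := Num.min alpha r^-1.
have ap : 0 < a by rewrite lt_min a0 invr_gt0 r0.
have aa : a <= alpha by rewrite ge_min lexx.
have ra : Num.min (r * alpha) 1 = r * a.
  by rewrite /a minr_pMr ?(ltW r0) // divff // gt_eqF.
have l0 : 0 < l1 by apply: lt_trans far.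
pose h z := a / l1 * Num.sg (f z - g z).
have al0 : 0 <= a / l1 by rewrite divr_ge0 // ltW.
have al1 : a / l1 <= 1 by rewrite ler_pdivrMr // mul1r; lra.
have sgn1 (x : R) : `|Num.sg x| <= 1 by rewrite normr_sg; case: (x != 0).
have h1 z : `|h z| <= 1.
  by rewrite normrM ger0_norm // mulr_ile1.
pose E (D : fdist R Z) := \sum_z D z * h z.
have gap : E f - E g = a.
  rewrite /E -sumrB (eq_bigr (fun z => a / l1 * `|f z - g z|)).
    by rewrite -mulr_sumr divfK // gt_eqF.
  by move=> z _; rewrite -mulrBl /h mulrCA [_ * Num.sg _]mulrC -normrEsg.
have close (D D' : fdist R Z) : \sum_z `|D z - D' z| <= alpha / 4 -> `|E D - E D'| <= a / 4.
  move=> dd; rewrite /E -sumrB.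
  apply: (@le_trans _ _ (\sum_z a / l1 * `|D z - D' z|)).
    apply: le_trans (ler_norm_sum _ _ _) _; apply: ler_sum => z _.
    rewrite -mulrBl normrM mulrC /h normrM (ger0_norm al0) ler_wpM2r //.
    by rewrite ger_pMr //; rewrite divr_gt0.
  rewrite -mulr_sumr mulrAC ler_pdivrMr //.
  apply: (@le_trans _ _ (a * (alpha / 4))); first by rewrite ler_pM2l.
  nra.
(* Centred at the midpoint, the mean under [f] is a/2; a [D] close to [f] moves it by at most a/4,
   so it stays in the window [a/4, a] that [clip_mean] asks for. *)
pose mid := (E f + E g) / 2.
have Ebound D : `|E D| <= 1.
  rewrite /E; apply: le_trans (ler_norm_sum _ _ _) _; rewrite -(fdist_sum D).
  apply: ler_sum => z _; rewrite normrM ger0_norm ?fdist_ge0 //.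
  by rewrite ler_piMr ?fdist_ge0.
have midb : `|mid| <= 1.
  have := Ebound f; have := Ebound g; rewrite /mid !ler_norml => /andP[? ?] /andP[? ?].
  by apply/andP; split; lra.
have h'2 z : `|h z - mid| <= 2.
  by apply: le_trans (ler_normB _ _) _; have := h1 z; lra.
have Eh' (D : fdist R Z) : \sum_z D z * (h z - mid) = E D - mid.
  under eq_bigr => z _ do rewrite mulrBr.
  by rewrite sumrB -mulr_suml fdist_sum mul1r.
have lna : ln alpha <= 0 by rewrite ln_le0.
have L1 : 1 <= L by lra.
have tau0 : 0 < 6 * L by lra.
have L0 : 0 < L by lra.
(* The choice tau = 6 L makes 1 - tau <= -5 + ln alpha, and e^5 >= 32; hence the left side is at
   most alpha, which is at most [r * a]. It is also the origin of 192 = 32 * 6. *)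
have tl : 32 * expR (1 - 6 * L) <= r * a.
  have ra' : alpha <= r * a.
    by rewrite -ra le_min a1 andbT ler_peMl // ltW.
  apply: le_trans ra'.
  have : expR (1 - 6 * L) <= expR (- 5 + ln alpha) by rewrite ler_expR; lra.
  rewrite (expRD (- 5)) lnK ?posrE // => e1.
  have e5 : expR (-5) <= 1 / 32 :> R.
    have e2 : 2 <= expR 1 :> R by have := @expR_ge1Dx R 1; lra.
    have : 2 ^+ 5 <= expR 1 ^+ 5 :> R by rewrite lerXn2r ?nnegrE ?expR_ge0.
    rewrite -expRM_natl mulr1 expRN => e3.
    rewrite -[leRHS]invrK lef_pV2 ?posrE ?expR_gt0 //; lra.
  have : expR (-5) * alpha <= 1 / 32 * alpha by rewrite ler_wpM2r // ltW.
  lra.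
set T := 4 * r * (6 * L).
have T0 : 0 < T by rewrite !mulr_gt0.
have ma : r * a <= 1 by rewrite -ra ge_min lexx orbT.
have c192 : 192 * L = 32 * (6 * L) by ring.
exists (fun u => clip T (\sum_i (h (u i) - mid)) / T); split.
- move=> u; rewrite normrM normrV ?unitfE ?gt_eqF // (gtr0_norm T0).
  by rewrite ler_pdivrMr // mul1r clip_norm // ltW.
- move=> D /close; rewrite ra c192 ler_norml => /andP[d1 d2].
  apply: (clip_mean (h := fun z => h z - mid)) => //.
  rewrite Eh'; move: gap d1 d2; rewrite /mid => ? ? ?; apply/andP; split; lra.
- move=> D /close; rewrite ra c192 ler_norml => /andP[d1 d2].
  (* Clipping is odd, so the claim for [g] is the claim for [f] with the statistic negated. *)
  rewrite lerNr.
  rewrite -sumrN (eq_bigr (fun u : {ffun 'I_m -> Z} =>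
      pw D u * (clip T (\sum_i - (h (u i) - mid)) / T))).
    apply: (clip_mean (h := fun z => - (h z - mid))) => //.
    + by move=> z; rewrite normrN.
    + under eq_bigr => z _ do rewrite mulrN.
      rewrite sumrN Eh'; move: gap d1 d2; rewrite /mid => ? ? ?; apply/andP; split; lra.
  by move=> u _; rewrite sumrN clipN ?(ltW T0) // mulNr mulrN.
Qed.

(** * Private hypothesis selection *)

Lemma sum_neighbors (R : realType) (Z : finType) (n m : nat) (phi : {ffun 'I_m -> Z} -> R)
    (x x' : database Z n m) :
  (forall u, `|phi u| <= 1) -> user_neighbors x x' ->
  - \sum_i phi (x i) <= - \sum_i phi (x' i) + 2.
Proof.
move=> ph [i hi]; rewrite (bigD1 i) //= [in leRHS](bigD1 i) //=.
rewrite (eq_bigr (fun j => phi (x' j))); last by move=> j /hi ->.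
have := ph (x i); have := ph (x' i); rewrite !ler_norml => /andP[? ?] /andP[? ?]; lra.
Qed.

Lemma user_neighbors_sym (Z : finType) (n m : nat) (x x' : database Z n m) :
  user_neighbors x x' -> user_neighbors x' x.
Proof. by move=> [i hi]; exists i => j /hi ->. Qed.

(* The score of [j] is [max(0, max_g - sum_i phi j g (x i))] over the [g] far from [j];
   one user moves it by at most 2. *)
Lemma hypothesis_selection (R : realType) (Z : finType) (O : Type) (n m M : nat)
    (o : 'I_M -> O) (phi : 'I_M -> 'I_M -> {ffun 'I_m -> Z} -> R)
    (far : rel 'I_M) (eps b : R) :
  (0 < M)%N -> injective o -> 0 < eps -> 0 < b <= 1 ->
  (forall j g u, `|phi j g u| <= 1) ->
  M%:R * expR (- (eps * n%:R * b / 8)) <= 1 / 6 ->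
  2 * M%:R * expR (- (n%:R * b ^+ 2 / 32)) <= 1 / 6 ->
  exists A : algorithm R Z O n m, user_DP A eps 0 /\
    forall (D : fdist R Z) (good : set O) (js : 'I_M),
      (forall g, far js g -> b <= \sum_u pw D u * phi js g u) ->
      (forall g, far g js -> \sum_u pw D u * phi g js u <= - b) ->
      (forall j, ~~ far j js -> good (o j)) ->
      2 / 3 <= success A D good.
Proof.
move=> M0 o_inj e0 /andP[b0 b1] ph hM1 hM2.
pose S j (x : database Z n m) := \big[Num.max/0]_(g | far j g) (- \sum_i phi j g (x i)).
have Sn j x x' : user_neighbors x x' -> S j x <= S j x' + 2.
  move=> xx'; apply: bigmax_le => [|g fg].
    by have : 0 <= S j x' := bigmax_ge_id _ _ _ _; lra.
  apply: le_trans (sum_neighbors (ph j g) xx') _; rewrite lerD2r.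
  exact: (le_bigmax_cond 0 (fun g => - \sum_i phi j g (x' i)) fg).
(* As scores have sensitivity 2, the factor eps/4 changes each weight by at most e^(eps/2); the
   normaliser accounts for the other e^(eps/2). *)
pose w x j := expR (- (eps / 4 * S j x)).
have w0 x j : 0 < w x j by exact: expR_gt0.
have wn x x' j : user_neighbors x x' -> w x j <= expR (eps / 2) * w x' j.
  move=> /user_neighbors_sym /(Sn j) h; rewrite -expRD ler_expR.
  have : eps / 4 * S j x' <= eps / 4 * (S j x + 2) by rewrite ler_pM2l //; lra.
  lra.
have W0 x : 0 < \sum_j w x j.
  rewrite (bigD1 (Ordinal M0)) //=; apply: ltr_pwDl => //.
  by apply: sumr_ge0 => j _; exact: ltW.
have /choice[run hrun] : forall x, exists P : fdist R 'I_M,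
    forall j, P j = w x j / \sum_j w x j.
  by move=> x; apply: normalize => // j; exact: ltW.
exists (Algorithm o_inj run); split.
  move=> x x' xx' A /=; rewrite addr0 /Prob mulr_sumr; apply: ler_sum => j _.
  rewrite !hrun ler_pdivrMr // mulrA mulrAC ler_pdivlMr //.
  have Wn : \sum_j w x' j <= expR (eps / 2) * \sum_j w x j.
    by rewrite mulr_sumr; apply: ler_sum => i _; apply/wn/user_neighbors_sym.
  have -> : expR eps = expR (eps / 2) * expR (eps / 2).
    by rewrite -expRD; congr expR; lra.
  have -> : expR (eps / 2) * expR (eps / 2) * w x' j * \sum_j w x j =
      expR (eps / 2) * w x' j * (expR (eps / 2) * \sum_j w x j) by ring.
  by apply: ler_pM => //; [exact: ltW | exact: ltW | exact: wn].
move=> D good js hpos hneg hgood.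
(* [B] counts the tests involving [js] that fall short of half their guaranteed mean; its
   expectation is the union bound over these tests. *)
pose B (x : database Z n m) : R :=
  \sum_(g | far js g) (\sum_i phi js g (x i) <= n%:R * b / 2)%R%:R +
  \sum_(g | far g js) (\sum_i - phi g js (x i) <= n%:R * b / 2)%R%:R.
have pD0 (u : {ffun 'I_m -> Z}) : 0 <= pw D u by apply: pw_ge0 => z; exact: fdist_ge0.
have pD1 : \sum_(u : {ffun 'I_m -> Z}) pw D u = 1 by rewrite sum_pw fdist_sum expr1n.
have EB : Eprod (pw D) B <= 1 / 6.
  rewrite /B EprodD !Eprod_exchange; apply: le_trans hM2.
  set t := expR _.
  have tM (A : pred 'I_M) : \sum_(g | A g) t <= M%:R * t.
    rewrite sumr_const -[leLHS]mulr_natl ler_wpM2r ?expR_ge0 // ler_nat.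
    by rewrite -[leqRHS]card_ord max_card.
  have -> : 2 * M%:R * t = M%:R * t + M%:R * t by ring.
  apply: lerD.
    apply: le_trans (tM [pred g | far js g]); apply: ler_sum => g fg.
    by apply: (tail_bound n pD0 pD1 (ph js g)); rewrite ?b0 ?b1 //; exact: hpos.
  apply: le_trans (tM [pred g | far g js]); apply: ler_sum => g fg.
  apply: (tail_bound n (phi := fun u => - phi g js u) pD0 pD1); rewrite ?b0 ?b1 //.
    by move=> u; rewrite normrN.
  under eq_bigr => u _ do rewrite mulrN.
  by rewrite sumrN lerNr; exact: hneg.
rewrite successE /=.
set G := (fun x => Prob _ _).
(* If a test fails, [B x] is at least 1. Otherwise [js] has score 0, so the normaliser is at least
   1, while every [j] far from [js] has score above n b / 2 and is drawn with probability at most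
   e^(- eps n b / 8). *)
have pt x : 5 / 6 <= G x + B x.
  have G0 : 0 <= G x by exact: Prob_ge0.
  have ind (c : bool) : 0 <= c%:R :> R by [].
  case: (boolP [exists g, far js g && (\sum_i phi js g (x i) <= n%:R * b / 2)]).
    move=> /existsP[g /andP[fg hg]]; rewrite /B (bigD1 g) //= hg /=.
    set s1 := \sum_(i | _) _; set s2 := \sum_(i | _) _.
    have : 0 <= s1 by exact: sumr_ge0.
    have : 0 <= s2 by exact: sumr_ge0.
    lra.
  move=> /existsPn n1.
  case: (boolP [exists g, far g js && (\sum_i - phi g js (x i) <= n%:R * b / 2)]).
    move=> /existsP[g /andP[fg hg]]; rewrite /B [X in _ + (_ + X)](bigD1 g) //= hg /=.
    set s1 := \sum_(i | _) _; set s2 := \sum_(i | _) _.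
    have : 0 <= s1 by exact: sumr_ge0.
    have : 0 <= s2 by exact: sumr_ge0.
    lra.
  move=> /existsPn n2.
  have B0 : 0 <= B x by rewrite addr_ge0 // sumr_ge0.
  have nb : 0 <= n%:R * b / 2 by rewrite !mulr_ge0 // ltW.
  have Sjs : S js x = 0.
    apply/eqP; rewrite eq_le bigmax_ge_id andbT; apply: bigmax_le => // g fg.
    by have := n1 g; rewrite fg /= -ltNge => ?; lra.
  have W1 : 1 <= \sum_j w x j.
    rewrite (bigD1 js) //= {1}/w Sjs mulr0 oppr0 expR0 lerDl.
    by apply: sumr_ge0 => j _; exact: ltW.
  have wbad j : far j js -> run x j <= expR (- (eps * n%:R * b / 8)).
    move=> fj; rewrite hrun ler_pdivrMr //.
    apply: (@le_trans _ _ (expR (- (eps * n%:R * b / 8)) * 1)); last first.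
      by rewrite ler_pM2l ?expR_gt0.
    rewrite mulr1 ler_expR lerN2.
    have : - \sum_i phi j js (x i) <= S j x.
      exact: (le_bigmax_cond 0 (fun g => - \sum_i phi j g (x i)) fj).
    have := n2 j; rewrite fj /= sumrN -ltNge => h1 h2.
    have : eps / 4 * (n%:R * b / 2) <= eps / 4 * S j x by rewrite ler_pM2l //; lra.
    lra.
  have : 1 <= G x + M%:R * expR (- (eps * n%:R * b / 8)).
    rewrite -[leLHS](fdist_sum (run x)).
    rewrite [leLHS](bigID [pred j | j \in [set j | `[< good (o j) >]]%SET]) /= lerD //.
    set e := expR _.
    have -> : M%:R * e = \sum_(j < M) e by rewrite sumr_const card_ord mulr_natl.
    rewrite [leRHS](bigID [pred j | j \notin [set j | `[< good (o j) >]]%SET]) /=.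
    rewrite -[leLHS]addr0 lerD //; last by apply: sumr_ge0 => j _; exact: expR_ge0.
    apply: ler_sum => j; rewrite inE => /asboolPn bj; apply: wbad.
    by apply: contrapT => /negP /hgood.
  lra.
have : 5 / 6 <= Eprod (pw D) G + Eprod (pw D) B.
  rewrite -EprodD -[leLHS](Eprod_cst n _ pD1); apply: Eprod_le => //.
lra.
Qed.

(** * A cover of the product distributions *)

Lemma bernoulli_ineq (R : realType) (n : nat) (x : R) :
  0 <= x <= 1 -> 1 - n%:R * x <= (1 - x) ^+ n.
Proof.
move=> /andP[x0 x1]; elim: n => [|n IH]; first by rewrite mul0r subr0 expr0.
rewrite exprS mulrSr; have n0 : 0 <= n%:R :> R by [].
have : (1 - x) * (1 - n%:R * x) <= (1 - x) * (1 - x) ^+ n by rewrite ler_wpM2l //; lra.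
have : 0 <= n%:R * x * x by rewrite !mulr_ge0.
lra.
Qed.

(** D - f is the difference of (1 - c) D and f - c D, two nonnegative functions of mass 1 - c. *)
Lemma L1_dominated (R : realType) (T : finType) (D f : fdist R T) (c : R) :
  c <= 1 -> (forall t, c * D t <= f t) -> \sum_t `|D t - f t| <= 2 * (1 - c).
Proof.
move=> c1 dom; apply: (@le_trans _ _ (\sum_t ((f t - c * D t) + (1 - c) * D t))).
  apply: ler_sum => t _; have D0 := fdist_ge0 D t; have := dom t => h.
  have : 0 <= (1 - c) * D t by rewrite mulr_ge0 // subr_ge0.
  by rewrite ler_norml => h2; apply/andP; split; lra.
rewrite big_split /= sumrB -!mulr_sumr !fdist_sum; lra.
Qed.

(* [Q c] has weights [c a + 1] with [c a] the integer part of [N * P a].  A pointwise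
   multiplicative bound passes to products without loss. *)
Lemma simplex_cover (R : realType) (k N : nat) : (0 < k)%N -> (0 < N)%N ->
  exists Q : {ffun 'I_k -> 'I_N.+1} -> fdist R 'I_k,
  forall P : fdist R 'I_k, exists c, forall a,
    (1 - k%:R / (N + k)%:R) * P a <= Q c a.
Proof.
move=> k0 N0.
have ex (c : {ffun 'I_k -> 'I_N.+1}) : exists P : fdist R 'I_k,
    forall a, P a = (c a).+1%:R / \sum_b (c b).+1%:R.
  apply: normalize => [//|]; rewrite (bigD1 (Ordinal k0)) //=.
  by apply: ltr_pwDl; rewrite ?ltr0n // sumr_ge0.
have [Q hQ] := choice ex.
exists Q => P.
have P1 a : P a <= 1.
  by rewrite -(fdist_sum P) (bigD1 a) //= lerDl sumr_ge0 // => b _; exact: fdist_ge0.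
have t0 a : 0 <= N%:R * P a by rewrite mulr_ge0 // fdist_ge0.
pose t a := Num.truncn (N%:R * P a).
have tb a : (t a)%:R <= N%:R * P a < (t a).+1%:R by exact: truncn_itv.
have tN a : (t a < N.+1)%N.
  rewrite ltnS -(ler_nat R); have /andP[h _] := tb a; apply: le_trans h _.
  by rewrite ler_piMr.
exists [ffun a => Ordinal (tN a)] => a; rewrite hQ.
under eq_bigr => b _ do rewrite ffunE /=.
rewrite ffunE /=.
have S0 : 0 < \sum_b (t b).+1%:R :> R.
  rewrite (bigD1 (Ordinal k0)) //=.
  by apply: ltr_pwDl; rewrite ?ltr0n // sumr_ge0.
have S1 : \sum_b (t b).+1%:R <= (N + k)%:R :> R.
  apply: (@le_trans _ _ (\sum_b (N%:R * P b + 1))).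
    by apply: ler_sum => b _; have /andP[h _] := tb b; rewrite -natr1 lerD2r.
  by rewrite big_split /= -mulr_sumr fdist_sum mulr1 sumr_const card_ord natrD.
have Nk : 0 < (N + k)%:R :> R by rewrite ltr0n addn_gt0 N0.
rewrite ler_pdivlMr //.
(* The weight of [a] exceeds N P(a), and the weights sum to at most N + k: rounding and normalising
   lose only the factor N / (N + k). *)
have -> : 1 - k%:R / (N + k)%:R = N%:R / (N + k)%:R :> R.
  by rewrite natrD; field; rewrite -natrD gt_eqF.
have /andP[_ h] := tb a.
apply: le_trans (ltW h).
have -> (S : R) : N%:R / (N + k)%:R * P a * S = N%:R * P a * (S / (N + k)%:R) by ring.
by rewrite ler_piMr // ler_pdivrMr // mul1r.
Qed.

(** An [algorithm] indexes its outputs injectively, so coinciding members of the cover must be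
    merged. Duplicates are removed among the mass functions, where equality is decidable. *)
Lemma finite_image (R : realType) (T I : finType) (f : I -> fdist R T) :
  (0 < #|I|)%N ->
  exists (M : nat) (o : 'I_M -> fdist R T),
    [/\ injective o, forall i, exists j, forall t, o j t = f i t, (M <= #|I|)%N & (0 < M)%N].
Proof.
move=> I0; pose s := undup [seq Defs.pmf (f i) | i <- enum I].
have ex (j : 'I_(size s)) : exists P : fdist R T, Defs.pmf P = tnth (in_tuple s) j.
  have : tnth (in_tuple s) j \in s by exact: mem_tnth.
  by rewrite mem_undup => /mapP[i _ ->]; exists (f i).
have [F hF] := choice ex.
exists (size s), F; split.
- move=> j j' e; apply/val_inj/eqP; have := hF j.
  rewrite e hF !(tnth_nth (Defs.pmf (F j))) /= => /eqP.
  by rewrite nth_uniq ?undup_uniq ?ltn_ord // eq_sym.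
- move=> i; have fs : Defs.pmf (f i) \in s by rewrite mem_undup map_f // mem_enum.
  have lt : (index (Defs.pmf (f i)) s < size s)%N by rewrite index_mem.
  exists (Ordinal lt) => t; rewrite hF (tnth_nth (Defs.pmf (f i))) /= nth_index //.
- by rewrite (leq_trans (size_undup _)) // size_map -cardE.
- have /card_gt0P[i _] := I0.
  have : Defs.pmf (f i) \in s by rewrite mem_undup map_f // mem_enum.
  by case: s {ex F hF}.
Qed.

Lemma product_cover (R : realType) (k d : nat) (alpha : R) : (0 < k)%N -> (0 < d)%N ->
  0 < alpha <= 1 ->
  exists (M : nat) (o : 'I_M -> fdist R {ffun 'I_d -> 'I_k}),
    [/\ injective o, (0 < M)%N,
        12 * M%:R <= expR (8 * (k%:R * d%:R) * (1 + ln (k%:R * d%:R / alpha))) &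
        forall D, is_product D -> exists j, \sum_z `|D z - o j z| <= alpha / 4].
Proof.
move=> k0 d0 /andP[a0 a1].
set q := k%:R * d%:R / alpha.
have kd1 : 1 <= k%:R * d%:R :> R by rewrite -natrM ler1n muln_gt0 k0.
have q1 : 1 <= q by rewrite ler_pdivlMr //; lra.
(* With N > 8 k d / alpha each coordinate loses a fraction k / (N + k), so the product loses at most
   alpha/8 of its mass by Bernoulli's inequality, that is alpha/4 in L1. *)
pose N := (Num.truncn (8 * q)).+1.
have /andP[N1 N2] : (Num.truncn (8 * q))%:R <= 8 * q < N%:R.
  by apply: truncn_itv; lra.
have [//|Q hQ] := @simplex_cover R k N k0.
have ex (c : {ffun 'I_d -> {ffun 'I_k -> 'I_N.+1}}) := prod_fdist (fun i => Q (c i)).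
have [f hf] := choice ex.
have Icard : #|{ffun 'I_d -> {ffun 'I_k -> 'I_N.+1}}| = (N.+1 ^ (k * d))%N.
  by rewrite !card_ffun !card_ord expnM.
have [|M [ o [ o_inj o_surj oM M0]]] := finite_image f.
  by rewrite Icard expn_gt0.
exists M, o; split => //.
  (* N + 1 <= 16 q <= e^(4 + ln q), and 12 <= e^4. The factor 12 lets 2M times a tail probability be
     at most 1/6 later. *)
  have e4 : 16 <= expR 4 :> R.
    have e2 : 2 <= expR 1 :> R by have := @expR_ge1Dx R 1; lra.
    have : 2 ^+ 4 <= expR 1 ^+ 4 :> R by rewrite lerXn2r ?nnegrE ?expR_ge0.
    rewrite -expRM_natl mulr1; lra.
  have q0 : 0 < q by lra.
  have NQ : N.+1%:R <= expR (4 + ln q) :> R.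
    rewrite expRD lnK ?posrE //.
    have : 16 * q <= expR 4 * q by rewrite ler_wpM2r //; lra.
    rewrite -natr1 /N -natr1; lra.
  have MQ : M%:R <= expR (4 + ln q) ^+ (k * d) :> R.
    apply: (@le_trans _ _ (N.+1%:R ^+ (k * d))).
      by rewrite -natrX ler_nat -Icard.
    by rewrite lerXn2r ?nnegrE ?expR_ge0.
  have lnq : 0 <= ln q by rewrite ln_ge0.
  apply: (@le_trans _ _ (expR 4 * expR (4 + ln q) ^+ (k * d))).
    by apply: ler_pM => //; lra.
  rewrite -expRM_natl -expRD ler_expR natrM.
  have : 0 <= (k%:R * d%:R - 1) * ln q by rewrite mulr_ge0 //; lra.
  set kd := k%:R * d%:R in kd1 * => h; nra.
move=> D [P hP].
have /choice[c hc] := fun i => hQ (P i).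
have [j hj] := o_surj [ffun i => c i]; exists j.
under eq_bigr => z _ do rewrite hj.
set x : R := k%:R / (N + k)%:R in hc.
have Nk : 0 < (N + k)%:R :> R by rewrite ltr0n.
have x01 : 0 <= x <= 1.
  rewrite divr_ge0 //= ler_pdivrMr // mul1r ler_nat leq_addl //.
have bern := bernoulli_ineq d x01.
have dx : d%:R * x <= alpha / 8.
  rewrite mulrA ler_pdivrMr //.
  have : alpha / 8 * (8 * q) = d%:R * k%:R by rewrite /q; field; rewrite gt_eqF.
  have : alpha / 8 * (8 * q) <= alpha / 8 * (N + k)%:R.
    rewrite ler_wpM2l ?divr_ge0 ?(ltW a0) //.
    by rewrite natrD; have : 0 <= k%:R :> R by []; lra.
  lra.
apply: (@le_trans _ _ (2 * (1 - (1 - x) ^+ d))); last lra.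
apply: L1_dominated.
  have /andP[x0 x1] := x01; rewrite exprn_ile1 //; lra.
move=> z; rewrite hP hf.
have -> : (1 - x) ^+ d = \prod_(i < d) (1 - x) by rewrite prodr_const card_ord.
rewrite -big_split /=; apply: ler_prod => i _; rewrite ffunE hc andbT.
have /andP[x0 x1] := x01.
by rewrite mulr_ge0 ?fdist_ge0 // subr_ge0.
Qed.

(** * Upper bound on the number of users *)

Lemma expR_absorb (R : realType) (c M X Y : R) :
  0 < c -> c * M <= expR X -> X <= Y -> M * expR (- Y) <= 1 / c.
Proof.
move=> c0 hM XY; rewrite div1r -[leRHS]mulr1 ler_pdivlMl // mulrA.
apply: (@le_trans _ _ (expR X * expR (- Y))).
  by rewrite ler_wpM2r // expR_ge0.
by rewrite -expRD -[leRHS]expR0 ler_expR subr_le0.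
Qed.

(** Here s = 1 / (alpha sqrt m) and t = min(alpha sqrt m, 1). The log-size of the cover brings one
    [L] and each power of the bias t / (192 L) another, hence [L ^+ 3] for the concentration term.
    The leading 1 comes from rounding up; it and the kd produced by t^-2 <= 1 + s^2 are absorbed by
    kd / eps. *)
Lemma sample_size_bound (R : realType) (kd L eps s t : R) :
  1 <= kd -> 1 <= L -> 0 < eps -> eps <= 1 -> 0 < s -> 0 < t ->
  t^-1 <= 1 + s -> t^-1 ^+ 2 <= 1 + s ^+ 2 ->
  1 + (64 * (kd * L) / (eps * (t / (192 * L))) + 256 * (kd * L) / (t / (192 * L)) ^+ 2)
  <= 10 ^+ 7 * L ^+ 3 * (kd / eps + kd * (s / eps) + kd * s ^+ 2).
Proof.
move=> kd1 L1 e0 e1 s0 t0 im im2.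
have L0 : 0 < L by exact: lt_le_trans L1.
have kd0 : 0 < kd by exact: lt_le_trans kd1.
have ie : 1 <= eps^-1 by rewrite invf_ge1.
have LL : L ^+ 2 <= L ^+ 3 by rewrite [leRHS]exprS ler_peMl // sqr_ge0.
have L31 : 1 <= L ^+ 3 by rewrite exprn_ege1.
have L30 : 0 < L ^+ 3 by exact: lt_le_trans L31.
have -> : 64 * (kd * L) / (eps * (t / (192 * L))) = 64 * 192 * (L ^+ 2 * (kd * (eps^-1 * t^-1))).
  by field; rewrite !gt_eqF.
have -> : 256 * (kd * L) / (t / (192 * L)) ^+ 2 = 256 * 192 ^+ 2 * (L ^+ 3 * (kd * t^-1 ^+ 2)).
  by field; rewrite !gt_eqF.
have B1 : L ^+ 2 * (kd * (eps^-1 * t^-1)) <= L ^+ 3 * (kd * (eps^-1 * (1 + s))).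
  apply: ler_pM => //; rewrite ?sqr_ge0 //.
    by rewrite !mulr_ge0 ?invr_ge0 ?(ltW e0) ?(ltW t0) ?(ltW kd0).
  by rewrite ler_pM2l // ler_pM2l ?invr_gt0.
have B2 : L ^+ 3 * (kd * t^-1 ^+ 2) <= L ^+ 3 * (kd * (eps^-1 + s ^+ 2)).
  by rewrite ler_pM2l // ler_pM2l //; apply: le_trans im2 _; rewrite lerD2r.
have B3 : 1 <= L ^+ 3 * (kd * eps^-1).
  by rewrite mulr_ege1 // mulr_ege1.
have p1 : 0 <= L ^+ 3 * (kd * (s / eps)).
  by rewrite !mulr_ge0 ?invr_ge0 ?(ltW e0) ?(ltW s0) ?(ltW kd0) ?(ltW L0).
have p2 : 0 <= L ^+ 3 * (kd * s ^+ 2).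
  by rewrite !mulr_ge0 ?(ltW kd0) ?(ltW L0) ?(ltW s0).
have -> : 10 ^+ 7 * L ^+ 3 * (kd / eps + kd * (s / eps) + kd * s ^+ 2) =
  10 ^+ 7 * (L ^+ 3 * (kd * eps^-1)) + 10 ^+ 7 * (L ^+ 3 * (kd * (s / eps)))
  + 10 ^+ 7 * (L ^+ 3 * (kd * s ^+ 2)) by ring.
have e1' : L ^+ 3 * (kd * (eps^-1 * (1 + s))) =
    L ^+ 3 * (kd * eps^-1) + L ^+ 3 * (kd * (s / eps)) by ring.
have e2 : L ^+ 3 * (kd * (eps^-1 + s ^+ 2)) =
    L ^+ 3 * (kd * eps^-1) + L ^+ 3 * (kd * s ^+ 2) by ring.
rewrite e1' in B1; rewrite e2 in B2.
move: (L ^+ 2 * _) (L ^+ 3 * (kd * t^-1 ^+ 2)) (L ^+ 3 * (kd * eps^-1))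
  (L ^+ 3 * (kd * (s / eps))) (L ^+ 3 * (kd * s ^+ 2)) B1 B2 B3 p1 p2
  => u v x y z B1 B2 B3 p1 p2.
clear -B1 B2 B3 p1 p2; lra.
Qed.

Lemma PD_upper (R : realType) (k d m : nat) (alpha eps : R) :
  (0 < k)%N -> (0 < d)%N -> (0 < m)%N -> 0 < alpha <= 1 -> 0 < eps <= 1 ->
  exists2 n : nat, user_solvable (PD k d alpha) m eps 0 n &
    n%:R <= 10 ^+ 7 * (1 + ln (k%:R * d%:R / alpha)) ^+ 3 *
      (k%:R * d%:R / eps + k%:R * d%:R / (alpha * eps * Num.sqrt m%:R)
       + k%:R * d%:R / (alpha ^+ 2 * m%:R)).
Proof.
move=> k0 d0 m0 /andP[a0 a1] /andP[e0 e1].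
have kd1 : 1 <= k%:R * d%:R :> R by rewrite -natrM ler1n muln_gt0 k0.
have [|M [ o [ o_inj M0 Mb cov]]] := product_cover k0 d0 (alpha := alpha); first by rewrite a0.
have q1 : alpha^-1 <= k%:R * d%:R / alpha.
  by rewrite ler_peMl // invr_ge0 ltW.
have ia : 1 <= alpha^-1 by rewrite invf_ge1.
have lnL : - ln alpha <= ln (k%:R * d%:R / alpha).
  by rewrite -lnV ?posrE // ler_ln ?posrE // ?invr_gt0 //; lra.
have lnq : 0 <= ln (k%:R * d%:R / alpha) by rewrite ln_ge0 //; lra.
set L := 1 + ln (k%:R * d%:R / alpha) in Mb *.
have L1 : 1 <= L by rewrite /L; lra.
set kd := k%:R * d%:R in kd1 Mb *.
set r : R := Num.sqrt m%:R.
have rr : r ^+ 2 = m%:R by rewrite sqr_sqrtr.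
have r0 : 0 < r by rewrite sqrtr_gt0 ltr0n.
have [b hb] : exists b, b = Num.min (r * alpha) 1 / (192 * L) by eexists.
have mn0 : 0 < Num.min (r * alpha) 1 by rewrite lt_min mulr_gt0 //= ltr01.
have b0 : 0 < b by rewrite hb divr_gt0 // mulr_gt0 //; lra.
have b1 : b <= 1.
  rewrite hb ler_pdivrMr; last by rewrite mulr_gt0 //; lra.
  apply: (@le_trans _ _ 1); first by rewrite ge_min lexx orbT.
  by rewrite mul1r; lra.
pose far (j g : 'I_M) := alpha < \sum_z `|o j z - o g z|.
(* Pairs that are not far get the zero test, which still meets the boundedness needed for
   privacy. *)
have ex (jg : 'I_M * 'I_M) : exists phi : {ffun 'I_m -> {ffun 'I_d -> 'I_k}} -> R,
    (forall u, `|phi u| <= 1) /\ (far jg.1 jg.2 ->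
        (forall D : fdist R {ffun 'I_d -> 'I_k}, \sum_z `|D z - o jg.1 z| <= alpha / 4 ->
          b <= \sum_u pw D u * phi u) /\
        (forall D : fdist R {ffun 'I_d -> 'I_k}, \sum_z `|D z - o jg.2 z| <= alpha / 4 ->
          \sum_u pw D u * phi u <= - b)).
  case: (boolP (far jg.1 jg.2)) => hf; last first.
    by exists (fun=> 0); split => // u; rewrite normr0.
  have [||phi [p1 p2 p3]] := test_exists m0 _ hf (L := L).
  - by rewrite a0.
  - by rewrite /L; lra.
  - by exists phi; rewrite hb.
have [phi hphi] := choice ex.
have L0 : 0 < L by exact: lt_le_trans L1.
have kd0 : 0 < kd by exact: lt_le_trans kd1.
have kL0 : 0 < kd * L by rewrite mulr_gt0.
have t1 : 0 < 64 * (kd * L) / (eps * b) by apply: divr_gt0; rewrite mulr_gt0.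
have t2 : 0 < 256 * (kd * L) / b ^+ 2 by apply: divr_gt0; rewrite ?exprn_gt0 // mulr_gt0.
have [n [n2 n3]] : exists n : nat,
    64 * (kd * L) / (eps * b) + 256 * (kd * L) / b ^+ 2 <= n%:R /\
    n%:R <= 1 + (64 * (kd * L) / (eps * b) + 256 * (kd * L) / b ^+ 2).
  set X := _ + _; exists (Num.truncn X).+1.
  have X0 : 0 <= X by rewrite addr_ge0 // ltW.
  have /andP[n1 n2] := truncn_itv X0.
  by rewrite (ltW n2) -natr1 addrC lerD2l.
exists n.
  have X1 : 8 * kd * L <= eps * n%:R * b / 8.
    have : 64 * (kd * L) / (eps * b) <= n%:R by apply: le_trans n2; rewrite lerDl ltW.
    rewrite ler_pdivrMr ?mulr_gt0 // => h; clear -h; lra.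
  have X2 : 8 * kd * L <= n%:R * b ^+ 2 / 32.
    have : 256 * (kd * L) / b ^+ 2 <= n%:R by apply: le_trans n2; rewrite lerDr ltW.
    rewrite ler_pdivrMr ?exprn_gt0 // => h; clear -h; lra.
  have c12 : 0 < 12 :> R by [].
  have [| | | A [dpA sA]] := @hypothesis_selection R _ _ n m M o
      (fun j g => phi (j, g)) far eps b M0 o_inj e0 _ (fun j g => (hphi (j, g)).1).
  - by rewrite b0.
  - by have := expR_absorb c12 Mb X1; lra.
  - have := expR_absorb c12 Mb X2; lra.
  exists A; split => // D vD.
  have [js hjs] := cov D vD.
  apply: (sA D _ js).
  - by move=> g fg; have [_ /(_ fg)[h _]] := hphi (js, g); exact: h.
  - by move=> g fg; have [_ /(_ fg)[_ h]] := hphi (g, js); exact: h.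
  (* The L1 distance is at most alpha + alpha/4, and total variation is half of it. *)
  - move=> j; rewrite -leNgt => nf /=; rewrite /dTV.
    have : \sum_z `|o j z - D z| <= \sum_z `|o j z - o js z| + \sum_z `|D z - o js z|.
      rewrite -big_split /=; apply: ler_sum => z _.
      by rewrite [`|D z - _|]distrC; exact: ler_distD.
    lra.
set s := (r * alpha)^-1.
have s0 : 0 < s by rewrite invr_gt0 mulr_gt0.
have -> : kd / (alpha * eps * r) = kd * (s / eps).
  by rewrite /s; field; rewrite !gt_eqF.
have -> : kd / (alpha ^+ 2 * m%:R) = kd * s ^+ 2.
  by rewrite /s -rr; field; rewrite !gt_eqF.
have im : (Num.min (r * alpha) 1)^-1 <= 1 + s.
  by rewrite /Order.min; case: ifP => _; rewrite ?invr1 -/s ?lerDr ?lerDl ?ltW.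
have im2 : (Num.min (r * alpha) 1)^-1 ^+ 2 <= 1 + s ^+ 2.
  have s2 : 0 <= s ^+ 2 by rewrite sqr_ge0.
  by rewrite /Order.min; case: ifP => _; rewrite ?invr1 ?expr1n -/s ?lerDr ?lerDl.
apply: le_trans n3 _; rewrite hb; exact: sample_size_bound.
Qed.

(** * Change of measure *)

(** Subtracting a constant from [G] does not change the difference of its means. With g = min G, the
    values lie in [g, (1 + K) g]; centring at the middle of this interval bounds the difference by 2
    t (K g / 2), and g is at most the mean under [Q]. *)
Lemma mean_shift (R : realType) (T : finType) (P Q G : T -> R) (K t : R) :
  \sum_u P u = 1 -> (forall u, 0 <= Q u) -> \sum_u Q u = 1 ->
  (forall u, 0 <= G u) -> 0 <= K -> (forall u v, G u <= (1 + K) * G v) ->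
  \sum_u `|P u - Q u| <= 2 * t ->
  \sum_u P u * G u <= (1 + t * K) * \sum_u Q u * G u.
Proof.
move=> P1 Q0 Q1 G0 K0 GK PQ.
have [u0 _] : exists u0 : T, true.
  case: (pickP (fun _ : T => true)) => [u _|no]; first by exists u.
  by move: P1; rewrite big_pred0 // => /esym/eqP; rewrite oner_eq0.
have [um _ hm] := @Order.TotalTheory.arg_minP _ R T u0 xpredT G isT.
set g := G um in hm.
have g0 : 0 <= g by exact: G0.
have mQ : g <= \sum_u Q u * G u.
  rewrite -[leLHS]mul1r -Q1 mulr_suml; apply: ler_sum => u _.
  by rewrite ler_wpM2l // hm.
have Kg : 0 <= K * g by exact: mulr_ge0.
have shift : \sum_u P u * G u - \sum_u Q u * G u =
    \sum_u (P u - Q u) * (G u - (g + K * g / 2)).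
  under [RHS]eq_bigr => u _ do rewrite mulrBr.
  rewrite sumrB -mulr_suml [X in _ - X * _]sumrB P1 Q1 subrr mul0r subr0 -sumrB.
  by apply: eq_bigr => u _; rewrite mulrBl.
have : \sum_u (P u - Q u) * (G u - (g + K * g / 2)) <= \sum_u `|P u - Q u| * (K * g / 2).
  apply: ler_sum => u _; apply: le_trans (ler_norm _) _; rewrite normrM ler_wpM2l //.
  have h1 : g <= G u by exact: hm.
  have h2 := GK u um; rewrite -/g in h2.
  by rewrite ler_norml; apply/andP; split; lra.
rewrite -mulr_suml -shift => h1.
have h2 : (\sum_u `|P u - Q u|) * (K * g / 2) <= 2 * t * (K * g / 2).
  by rewrite ler_wpM2r //; lra.
have t0 : 0 <= 2 * t by apply: le_trans PQ; apply: sumr_ge0.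
have h3 : t * K * g <= t * K * \sum_u Q u * G u.
  by rewrite ler_wpM2l // mulr_ge0 //; lra.
rewrite mulrDl mul1r; lra.
Qed.

(* Pure privacy bounds [g] within a factor [1 + K], so its oscillation is at most [K]
   times its minimum: this makes each replacement a multiplicative step. *)
Lemma dp_hybrid (R : realType) (T : finType) (n : nat) (P Q : T -> R)
    (g : {ffun 'I_n -> T} -> R) (K t : R) :
  (forall u, 0 <= P u) -> \sum_u P u = 1 -> (forall u, 0 <= Q u) -> \sum_u Q u = 1 ->
  (forall x, 0 <= g x) -> 0 <= K -> \sum_u `|P u - Q u| <= 2 * t ->
  (forall x x' : {ffun 'I_n -> T}, (exists i, forall j, j != i -> x j = x' j) ->
    g x <= (1 + K) * g x') ->
  Eprod P g <= (1 + t * K) ^+ n * Eprod Q g.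
Proof.
move=> P0 P1 Q0 Q1 + K0 PQ.
have t0 : 0 <= 2 * t by apply: le_trans PQ; apply: sumr_ge0.
have tK : 0 <= 1 + t * K by rewrite addr_ge0 // mulr_ge0 //; lra.
elim: n g => [|n IH] g g0 gn.
  rewrite expr0 mul1r le_eqVlt; apply/orP; left; apply/eqP.
  by apply: eq_bigr => x _; rewrite /pw !big_ord0.
rewrite !EprodS exprS -mulrA.
(* Induction moves the later users from [P] to [Q] with the first one fixed. The average [G]
   inherits the ratio bound of [g], so [mean_shift] then moves the first user. *)
pose G u := Eprod Q (fun y => g (ffcons u y)).
apply: (@le_trans _ _ (\sum_u P u * ((1 + t * K) ^+ n * G u))).
  apply: ler_sum => u _; rewrite ler_wpM2l //; apply: IH => // x x' [i hi].
  apply: gn; exists (lift ord0 i) => j; case: (unliftP ord0 j) => [j' -> |->].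
    by rewrite (inj_eq (@lift_inj _ ord0)) !ffconsS => /hi.
  by rewrite !ffcons0.
under eq_bigr => u _ do rewrite mulrCA.
rewrite -mulr_sumr [leRHS]mulrCA ler_wpM2l ?exprn_ge0 //.
apply: mean_shift => //.
  by move=> u; apply: Eprod_ge0.
move=> u v; rewrite /G -EprodZ; apply: Eprod_le => // y; apply: gn.
exists ord0 => j; case: (unliftP ord0 j) => [j' -> |->]; last by rewrite eqxx.
by rewrite !ffconsS.
Qed.

Lemma chi2_expand (R : realType) (T : finType) (P Q : T -> R) :
  (forall u, 0 < Q u) -> \sum_u P u = 1 -> \sum_u Q u = 1 ->
  \sum_u (P u - Q u) ^+ 2 / Q u = \sum_u P u ^+ 2 / Q u - 1.
Proof.
move=> Q0 P1 Q1; rewrite (eq_bigr (fun u => P u ^+ 2 / Q u - 2 * P u + Q u)).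
  by rewrite big_split /= sumrB -mulr_sumr P1 Q1; lra.
by move=> u _; field; rewrite gt_eqF.
Qed.

(* Cauchy-Schwarz in the form of AM-GM with the optimal weight [B]. *)
Lemma chi2_L1 (R : realType) (T : finType) (P Q : T -> R) (B : R) :
  (forall u, 0 < Q u) -> \sum_u P u = 1 -> \sum_u Q u = 1 -> 0 < B ->
  \sum_u P u ^+ 2 / Q u <= 1 + B ^+ 2 -> \sum_u `|P u - Q u| <= B.
Proof.
move=> Q0 P1 Q1 B0 chi.
apply: (@le_trans _ _ (\sum_u (B^-1 / 2 * ((P u - Q u) ^+ 2 / Q u) + B / 2 * Q u))).
  apply: ler_sum => u _; rewrite -(real_normK (num_real (P u - Q u))).
  set x := `|_|.
  rewrite -subr_ge0 (_ : _ - _ = (x - B * Q u) ^+ 2 / (2 * B * Q u)).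
    by rewrite divr_ge0 ?sqr_ge0 // !mulr_ge0 // ltW.
  by field; rewrite !gt_eqF.
rewrite big_split /= -!mulr_sumr chi2_expand // Q1.
have : B^-1 / 2 * (\sum_u P u ^+ 2 / Q u - 1) <= B^-1 / 2 * B ^+ 2.
  by rewrite ler_wpM2l ?divr_ge0 ?invr_ge0 ?(ltW B0) //; lra.
have -> : B^-1 / 2 * B ^+ 2 = B / 2 by field; rewrite gt_eqF.
lra.
Qed.

(** Pointwise AM-GM, from the square of l (P - Q) - Q g, followed by g^2 <= g. The weight [l] stays
    free so that it can be matched to the small mean of [g] under [Q]. *)
Lemma chi2_event (R : realType) (T : finType) (P Q g : T -> R) (B l : R) :
  (forall u, 0 < Q u) -> \sum_u P u = 1 -> \sum_u Q u = 1 -> 0 < l ->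
  (forall u, 0 <= g u <= 1) -> \sum_u P u ^+ 2 / Q u <= 1 + B ->
  \sum_u P u * g u - \sum_u Q u * g u <= (l * B + (\sum_u Q u * g u) / l) / 2.
Proof.
move=> Q0 P1 Q1 l0 g01 chi; rewrite -sumrB.
apply: (@le_trans _ _ (\sum_u (l / 2 * ((P u - Q u) ^+ 2 / Q u) + (2 * l)^-1 * (Q u * g u)))).
  apply: ler_sum => u _.
  apply: (@le_trans _ _ (l / 2 * ((P u - Q u) ^+ 2 / Q u) + (2 * l)^-1 * (Q u * g u ^+ 2))).
    rewrite -mulrBl -subr_ge0.
    rewrite (_ : _ - _ = (l * (P u - Q u) - Q u * g u) ^+ 2 / (2 * l * Q u)).
      by rewrite divr_ge0 ?sqr_ge0 // !mulr_ge0 // ltW.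
    by field; rewrite !gt_eqF.
  rewrite lerD2l ler_wpM2l ?invr_ge0 ?mulr_ge0 ?(ltW l0) // ler_wpM2l ?(ltW (Q0 u)) //.
  by have /andP[? ?] := g01 u; rewrite expr2 ler_piMl.
rewrite big_split /= -!mulr_sumr chi2_expand //.
have : l / 2 * (\sum_u P u ^+ 2 / Q u - 1) <= l / 2 * B by rewrite ler_wpM2l //; lra.
have -> : (2 * l)^-1 * \sum_u Q u * g u = (\sum_u Q u * g u) / l / 2.
  by field; rewrite gt_eqF.
lra.
Qed.

(** The second moment of the likelihood ratio, one plus the chi-square divergence for distributions,
    is multiplicative over independent draws. *)
Lemma chi2_pw (R : realType) (T : finType) (n : nat) (P Q : T -> R) :
  \sum_(x : {ffun 'I_n -> T}) pw P x ^+ 2 / pw Q x = (\sum_u P u ^+ 2 / Q u) ^+ n.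
Proof.
rewrite -sum_pw; apply: eq_bigr => x _.
by rewrite /pw -prodrXl -prodf_div.
Qed.

(** * A hard family of product distributions *)

Lemma sum_inj_le (R : realType) (I T : finType) (e : I -> T) (A : pred T) (F : T -> R) :
  injective e -> (forall i, A (e i)) -> (forall t, 0 <= F t) ->
  \sum_i F (e i) <= \sum_(t | A t) F t.
Proof.
move=> e_inj eA F0.
have -> : \sum_i F (e i) = \sum_(t in [set e i | i in I]) F t.
  by rewrite big_imset //= => i j _ _; exact: e_inj.
rewrite [leLHS]big_mkcond [leRHS]big_mkcond /=; apply: ler_sum => t _.
by case: imsetP => [[i _ ->]|_]; [rewrite eA | case: ifP].
Qed.

Definition ham (I : finType) (v w : {ffun I -> bool}) : nat := #|[pred p | v p != w p]|.

(* Weigh [v] by [x ^ ham v w] with [x = (9/10)^32]. *)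
Lemma hamming_ball (R : realType) (I : finType) (w : {ffun I -> bool}) :
  (#|[pred v | (32 * ham v w <= #|I|)%N]|)%:R <= (6 / 5) ^+ #|I| :> R.
Proof.
pose y : R := 9 / 10; pose x : R := y ^+ 32.
have x8 : 0 <= x <= 2 / 25.
  have y8 : 0 <= y ^+ 8 <= 1 / 2 by rewrite /y; apply/andP; split; lra.
  rewrite /x (exprM y 8 4) exprn_ge0 /=; last by case/andP: y8.
  have : (y ^+ 8) ^+ 4 <= (1 / 2) ^+ 4 :> R.
    by case/andP: y8 => ? ?; rewrite lerXn2r // ?nnegrE //; lra.
  lra.
have y0 : 0 < y by rewrite /y; lra.
have y1 : y <= 1 by rewrite /y; lra.
have tot : \sum_(v : {ffun I -> bool}) \prod_p (if v p != w p then x else 1) = (1 + x) ^+ #|I|.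
  rewrite -(bigA_distr_bigA (fun p (b : bool) => if b != w p then x else 1)).
  rewrite (eq_bigr (fun=> 1 + x)) ?prodr_const // => p _.
  by rewrite big_bool; case: (w p) => /=; rewrite addrC.
(* On the ball the weight y^(32 ham) is at least y^|I|. The ratio then works out because 1 + 2/25 =
   (6/5)(9/10). *)
have card : (#|[pred v | (32 * ham v w <= #|I|)%N]|)%:R * y ^+ #|I| <= (1 + x) ^+ #|I|.
  rewrite -tot mulr_natl -sumr_const big_mkcond /=; apply: ler_sum => v _.
  rewrite -big_mkcond /= prodr_const; case: ifP => [|_]; last first.
    by rewrite exprn_ge0 //; case/andP: x8.
  rewrite inE => hv; rewrite -exprM; apply: ler_wiXn2l => //; exact: ltW.
have -> : (6 / 5) ^+ #|I| = (6 / 5 * y) ^+ #|I| / y ^+ #|I| :> R.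
  by rewrite (exprMn _ (6 / 5) y) mulfK // expf_eq0 gt_eqF // andbF.
rewrite ler_pdivlMr ?exprn_gt0 //; apply: le_trans card _.
by case/andP: x8 => ? ?; rewrite lerXn2r // ?nnegrE /y; lra.
Qed.

Definition origin (d k : nat) : {ffun 'I_d * 'I_k -> bool} := [ffun=> false].

(* [odds eta v (i, b)] is the ratio of the probabilities of the symbols [b + 1] and [0]
   in coordinate [i]. *)
Definition odds (R : realType) (d k : nat) (eta : R) (v : {ffun 'I_d * 'I_k -> bool})
    (p : 'I_d * 'I_k) : R :=
  (1 + eta * (v p)%:R) / (d%:R * k%:R).

Definition odds_total (R : realType) (d k : nat) (eta : R) (v : {ffun 'I_d * 'I_k -> bool})
    (i : 'I_d) : R := 1 + \sum_b odds eta v (i, b).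

Definition odds_weight (R : realType) (d k : nat) (eta : R) (v : {ffun 'I_d * 'I_k -> bool})
    (i : 'I_d) (a : 'I_k.+1) : R :=
  if unlift ord0 a is Some b then odds eta v (i, b) else 1.

Lemma odds_gt0 (R : realType) (d k : nat) (eta : R) (v : {ffun 'I_d * 'I_k -> bool}) p :
  0 <= eta -> 0 < odds eta v p.
Proof.
move=> e0; case: p => i b; rewrite divr_gt0 //.
  by apply: ltr_pwDl => //; rewrite mulr_ge0.
by rewrite mulr_gt0 // ltr0n; [have := ltn_ord i | have := ltn_ord b]; exact: leq_ltn_trans.
Qed.

Lemma odds_weight_gt0 (R : realType) (d k : nat) (eta : R)
    (v : {ffun 'I_d * 'I_k -> bool}) i a :
  0 <= eta -> 0 < odds_weight eta v i a.
Proof. by rewrite /odds_weight; case: (unlift _ _) => [b|//]; exact: odds_gt0. Qed.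

Lemma odds_weight_sum (R : realType) (d k : nat) (eta : R)
    (v : {ffun 'I_d * 'I_k -> bool}) i :
  \sum_a odds_weight eta v i a = odds_total eta v i.
Proof.
rewrite big_ord_recl /odds_weight unlift_none /odds_total; congr (_ + _).
by apply: eq_bigr => b _; rewrite liftK.
Qed.

Lemma odds_total_gt0 (R : realType) (d k : nat) (eta : R)
    (v : {ffun 'I_d * 'I_k -> bool}) i : 0 <= eta -> 0 < odds_total eta v i.
Proof.
by move=> e0; apply: ltr_pwDl => //; apply: sumr_ge0 => b _; apply/ltW/odds_gt0.
Qed.

Lemma odds_fdist (R : realType) (d k : nat) (eta : R) : 0 <= eta ->
  exists D : {ffun 'I_d * 'I_k -> bool} -> fdist R {ffun 'I_d -> 'I_k.+1},
  forall v, is_product (D v) /\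
    forall z, D v z = \prod_i (odds_weight eta v i (z i) / odds_total eta v i).
Proof.
move=> e0; suff /choice[D hD] : forall v, exists D : fdist R {ffun 'I_d -> 'I_k.+1},
    is_product D /\ forall z, D z = \prod_i (odds_weight eta v i (z i) / odds_total eta v i).
  by exists D.
move=> v; have /choice[P hP] : forall i, exists P : fdist R 'I_k.+1,
    forall a, P a = odds_weight eta v i a / odds_total eta v i.
  move=> i; rewrite -odds_weight_sum; apply: normalize => [a|].
    exact/ltW/odds_weight_gt0.
  by rewrite odds_weight_sum odds_total_gt0.
have [D hD] := prod_fdist P; exists D; split; first by exists P.
by move=> z; rewrite hD; apply: eq_bigr => i _; exact: hP.
Qed.

Lemma odds_sum (R : realType) (d k : nat) (eta : R) (v : {ffun 'I_d * 'I_k -> bool}) (i : 'I_d) :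
  (0 < k)%N -> \sum_b odds eta v (i, b) =
    d%:R^-1 + eta * ((\sum_b (v (i, b))%:R) / (d%:R * k%:R)).
Proof.
move=> k0; have d0 : (0 < d)%N := leq_ltn_trans (leq0n i) (ltn_ord i).
rewrite /odds -mulr_suml big_split /= sumr_const card_ord -mulr_sumr.
field; rewrite !pnatr_eq0 -!lt0n d0 k0 //.
Qed.

Lemma odds_frac (R : realType) (d k : nat) (v : {ffun 'I_d * 'I_k -> bool}) (i : 'I_d) :
  (0 < k)%N -> 0 <= (\sum_b (v (i, b))%:R : R) / (d%:R * k%:R) <= d%:R^-1.
Proof.
move=> k0; have d0 : (0 < d)%N := leq_ltn_trans (leq0n i) (ltn_ord i).
rewrite divr_ge0 ?sumr_ge0 // ?mulr_ge0 //= ler_pdivrMr ?mulr_gt0 ?ltr0n //.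
rewrite mulKf ?pnatr_eq0 -?lt0n //.
apply: (@le_trans _ _ (\sum_(b < k) 1)); last by rewrite sumr_const card_ord.
by apply: ler_sum => b _; case: (v _).
Qed.

(** With s = 1 + 1/d and x <= 1/d the share of perturbed cells, the sum equals s (s + (2 eta +
    eta^2) x) / (s + eta x)^2. The normaliser cancels the part linear in eta, leaving at most 1 +
    eta^2 x. *)
Lemma odds_chi2_coord (R : realType) (d k : nat) (eta : R)
    (v : {ffun 'I_d * 'I_k -> bool}) (i : 'I_d) :
  (0 < k)%N -> 0 <= eta ->
  \sum_a (odds_weight eta v i a / odds_total eta v i) ^+ 2 /
         (odds_weight eta (origin d k) i a / odds_total eta (origin d k) i) <= 1 + eta ^+ 2 / d%:R.
Proof.
move=> k0 e0; set v0 := origin d k.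
have d0 : (0 < d)%N := leq_ltn_trans (leq0n i) (ltn_ord i).
have dR : 0 < d%:R :> R by rewrite ltr0n.
have kR : 0 < k%:R :> R by rewrite ltr0n.
have T0 := odds_total_gt0 v i e0; have T00 := odds_total_gt0 v0 i e0.
have /andP[x0 x1] := odds_frac R v i k0.
set x := (\sum_b (v (i, b))%:R) / _ in x0 x1.
have Tv : odds_total eta v i = 1 + d%:R^-1 + eta * x.
  by rewrite /odds_total odds_sum // addrA.
have Tv0 : odds_total eta v0 i = 1 + d%:R^-1.
  rewrite /odds_total odds_sum // big1 ?mul0r ?mulr0 ?addr0 // => b _.
  by rewrite ffunE.
have sq : \sum_a odds_weight eta v i a ^+ 2 / odds_weight eta v0 i a =
    1 + d%:R^-1 + (2 * eta + eta ^+ 2) * x.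
  rewrite big_ord_recl /odds_weight unlift_none expr1n divr1 -addrA; congr (_ + _).
  rewrite (eq_bigr (fun b => odds (2 * eta + eta ^+ 2) v (i, b))).
    by rewrite odds_sum.
  move=> b _; rewrite liftK /odds ffunE mulr0 addr0.
  by case: (v (i, b)); rewrite ?mulr1 ?mulr0; field; rewrite !gt_eqF.
rewrite (eq_bigr (fun a => odds_total eta v0 i / odds_total eta v i ^+ 2 *
     (odds_weight eta v i a ^+ 2 / odds_weight eta v0 i a))); last first.
  by move=> a _; field; rewrite !gt_eqF // odds_weight_gt0.
rewrite -mulr_sumr sq Tv Tv0; rewrite Tv in T0.
set s := 1 + d%:R^-1 in T0 *.
have s1 : 1 <= s by rewrite lerDl invr_ge0 ltW.
rewrite mulrAC ler_pdivrMr ?exprn_gt0 //.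
apply: (@le_trans _ _ ((1 + eta ^+ 2 * x) * (s + eta * x) ^+ 2)).
  have p1 : 0 <= eta * x by rewrite mulr_ge0.
  have p2 : 0 <= eta ^+ 2 * x by rewrite mulr_ge0 ?sqr_ge0.
  have p3 : 0 <= eta ^+ 2 * x * (s * (s - 1)) by rewrite mulr_ge0 // mulr_ge0 //; lra.
  have p4 : 0 <= eta ^+ 2 * x * (2 * s * (eta * x) + (eta * x) ^+ 2).
    rewrite mulr_ge0 // addr_ge0 ?sqr_ge0 // mulr_ge0 //; lra.
  have p5 : 0 <= (eta * x) ^+ 2 by rewrite sqr_ge0.
  lra.
by rewrite ler_wpM2r ?sqr_ge0 // lerD2l ler_wpM2l ?sqr_ge0.
Qed.

(** The rarity 1/d of non-default symbols offsets the [d] coordinates, so the bound per example is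
    free of [d] and [k]. *)
Lemma odds_chi2 (R : realType) (d k : nat) (eta : R) (v : {ffun 'I_d * 'I_k -> bool})
    (P Q : {ffun 'I_d -> 'I_k.+1} -> R) :
  (0 < d)%N -> (0 < k)%N -> 0 <= eta ->
  (forall z, P z = \prod_i (odds_weight eta v i (z i) / odds_total eta v i)) ->
  (forall z, Q z = \prod_i (odds_weight eta (origin d k) i (z i) /
     odds_total eta (origin d k) i)) ->
  \sum_z P z ^+ 2 / Q z <= expR (eta ^+ 2).
Proof.
move=> d0 k0 e0 hP hQ.
pose F i a := (odds_weight eta v i a / odds_total eta v i) ^+ 2 /
         (odds_weight eta (origin d k) i a / odds_total eta (origin d k) i).
rewrite (eq_bigr (fun z : {ffun 'I_d -> 'I_k.+1} => \prod_i F i (z i))); last first.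
  by move=> z _; rewrite hP hQ -prodrXl -prodf_div.
rewrite -(bigA_distr_bigA F).
apply: (@le_trans _ _ (\prod_(i < d) expR (eta ^+ 2 / d%:R))).
  apply: ler_prod => i _; apply/andP; split.
    apply: sumr_ge0 => a _; rewrite divr_ge0 ?sqr_ge0 // divr_ge0 // ltW //.
      exact: odds_weight_gt0.
    exact: odds_total_gt0.
  by apply: le_trans (odds_chi2_coord v i k0 e0) _; exact: expR_ge1Dx.
rewrite prodr_const card_ord -expRM_natl ler_expR mulrC divfK //.
by rewrite pnatr_eq0 -lt0n.
Qed.

(** * Separation of the hard family in L1 distance *)

Definition odds_zero (R : realType) (d k : nat) (eta : R) (v : {ffun 'I_d * 'I_k -> bool}) : R :=
  \prod_i (odds_total eta v i)^-1.

Definition single (d k : nat) (p : 'I_d * 'I_k) : {ffun 'I_d -> 'I_k.+1} :=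
  [ffun j => if j == p.1 then lift ord0 p.2 else ord0].

Lemma single_inj (d k : nat) : injective (@single d k).
Proof.
move=> [i a] [j b] /ffunP /(_ i); rewrite !ffunE /= eqxx.
case: eqP => [<- /lift_inj -> //|_] /eqP.
by rewrite eq_sym (negbTE (neq_lift _ _)).
Qed.

Lemma odds_at_zero (R : realType) (d k : nat) (eta : R) (v : {ffun 'I_d * 'I_k -> bool}) :
  \prod_i (odds_weight eta v i ([ffun=> ord0] i) / odds_total eta v i) = odds_zero eta v.
Proof.
by apply: eq_bigr => i _; rewrite ffunE /odds_weight unlift_none mul1r.
Qed.

Lemma odds_at_single (R : realType) (d k : nat) (eta : R) (v : {ffun 'I_d * 'I_k -> bool}) p :
  \prod_i (odds_weight eta v i (single p i) / odds_total eta v i) =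
  odds_zero eta v * odds eta v p.
Proof.
rewrite big_split /= mulrC; congr (_ * _); case: p => i b.
rewrite (bigD1 i) //= big1 => [|j ji].
  by rewrite ffunE /= eqxx /odds_weight liftK mulr1.
by rewrite ffunE /= (negbTE ji) /odds_weight unlift_none.
Qed.

Lemma odds_le (R : realType) (d k : nat) (eta : R) (v : {ffun 'I_d * 'I_k -> bool}) p :
  0 <= eta <= 1 -> odds eta v p <= 2 / (d%:R * k%:R).
Proof.
move=> /andP[e0 e1]; rewrite /odds ler_wpM2r ?invr_ge0 ?mulr_ge0 //.
by case: (v p); rewrite ?mulr1 ?mulr0; lra.
Qed.

(** Each normaliser is at most 1 + 2/d, so their product is at most e^2 <= 16. *)
Lemma odds_zero_ge (R : realType) (d k : nat) (eta : R) (v : {ffun 'I_d * 'I_k -> bool}) :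
  (0 < d)%N -> (0 < k)%N -> 0 <= eta <= 1 -> 1 / 16 <= odds_zero eta v.
Proof.
move=> d0 k0 e01; have /andP[e0 e1] := e01.
have e16 : expR 2 <= 16 :> R.
  have h : expR (1 / 2) <= 2 :> R by apply: le_trans (expR_quad _) _ => //; lra.
  have -> : 2 = 4%:R * (1 / 2) :> R by lra.
  rewrite expRM_natl; apply: (@le_trans _ _ (2 ^+ 4)); last lra.
  by rewrite lerXn2r ?nnegrE ?expR_ge0.
have ub : \prod_i odds_total eta v i <= 16.
  apply: le_trans e16; apply: (@le_trans _ _ (\prod_(i < d) expR (2 / d%:R))).
    apply: ler_prod => i _; rewrite ltW ?odds_total_gt0 //=.
    apply: le_trans (expR_ge1Dx _); rewrite lerD2l odds_sum //.
    have /andP[x0 x1] := odds_frac R v i k0.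
    set x := _ / _ in x0 x1 *.
    have : eta * x <= 1 * d%:R^-1 by rewrite ler_pM.
    lra.
  rewrite prodr_const card_ord -expRM_natl ler_expR mulrC divfK //.
  by rewrite pnatr_eq0 -lt0n.
have pos : 0 < \prod_i odds_total eta v i.
  by apply: prodr_gt0 => i _; exact: odds_total_gt0.
by rewrite /odds_zero prodfV div1r lef_pV2 // posrE.
Qed.

(* Only the all-default point and the points with one non-default coordinate are used.
   If the masses [Zv], [Zw] of the former differ a lot, that already separates. *)
Lemma odds_L1 (R : realType) (d k : nat) (eta : R) (v w : {ffun 'I_d * 'I_k -> bool})
    (P Q : {ffun 'I_d -> 'I_k.+1} -> R) :
  (0 < d)%N -> (0 < k)%N -> 0 <= eta <= 1 ->
  (forall z, P z = \prod_i (odds_weight eta v i (z i) / odds_total eta v i)) ->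
  (forall z, Q z = \prod_i (odds_weight eta w i (z i) / odds_total eta w i)) ->
  eta * (ham v w)%:R / (32 * (d%:R * k%:R)) <= \sum_z `|P z - Q z|.
Proof.
move=> d0 k0 e01 hP hQ; have /andP[e0 e1] := e01.
have dk0 : 0 < d%:R * k%:R :> R by rewrite mulr_gt0 ?ltr0n.
set Zv := odds_zero eta v; set Zw := odds_zero eta w.
have Zv16 : 1 / 16 <= Zv by exact: odds_zero_ge.
pose z0 : {ffun 'I_d -> 'I_k.+1} := [ffun=> ord0].
pose A := `|Zv - Zw|.
have A0 : 0 <= A := normr_ge0 _.
have S1 : A + \sum_p `|Zv * odds eta v p - Zw * odds eta w p| <= \sum_z `|P z - Q z|.
  rewrite [leRHS](bigD1 z0) //= hP hQ !odds_at_zero lerD2l.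
  under eq_bigr => p _ do rewrite -!odds_at_single -hP -hQ.
  apply: (@sum_inj_le _ _ _ (@single d k) (fun z => z != z0) (fun z => `|P z - Q z|)) => //.
    exact: single_inj.
  move=> [i b]; apply/eqP => /ffunP /(_ i); rewrite !ffunE /= eqxx => /eqP.
  by rewrite eq_sym (negbTE (neq_lift _ _)).
have S2 : Zv * \sum_p `|odds eta v p - odds eta w p| - A * \sum_p odds eta w p
    <= \sum_p `|Zv * odds eta v p - Zw * odds eta w p|.
  rewrite !mulr_sumr -sumrB; apply: ler_sum => p _.
  have Z0 : 0 <= Zv by lra.
  have w0 : 0 <= odds eta w p by apply/ltW/odds_gt0.
  have -> : Zv * odds eta v p - Zw * odds eta w p =
    Zv * (odds eta v p - odds eta w p) - - ((Zv - Zw) * odds eta w p) by ring.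
  have := lerB_dist (Zv * (odds eta v p - odds eta w p)) (- ((Zv - Zw) * odds eta w p)).
  have -> : `|- ((Zv - Zw) * odds eta w p)| = A * odds eta w p.
    by rewrite normrN normrM (ger0_norm w0).
  by rewrite [in `|Zv * _|]normrM (ger0_norm Z0).
have S3 : \sum_p odds eta w p <= 2.
  apply: (@le_trans _ _ (\sum_(p : 'I_d * 'I_k) 2 / (d%:R * k%:R))).
    by apply: ler_sum => p _; exact: odds_le.
  rewrite sumr_const card_prod !card_ord -[leLHS]mulr_natl natrM mulrC divfK //.
  by rewrite gt_eqF.
have S4 : \sum_p `|odds eta v p - odds eta w p| = eta * (ham v w)%:R / (d%:R * k%:R).
  have -> : (ham v w)%:R = \sum_p (v p != w p)%:R :> R.
    rewrite /ham -sum1_card natr_sum big_mkcond; apply: eq_bigr => p _.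
    by rewrite inE; case: (_ != _).
  rewrite mulrAC mulr_sumr; apply: eq_bigr => p _.
  have c0 : 0 <= (d%:R * k%:R)^-1 :> R by rewrite invr_ge0 ltW.
  rewrite /odds -mulrBl normrM (ger0_norm c0).
  case: (v p); case: (w p) => /=;
    rewrite ?mulr1 ?mulr0 ?addr0 ?subrr ?normr0 ?mul0r //.
    by rewrite addrAC subrr add0r ger0_norm.
  by rewrite opprD addrA subrr add0r normrN ger0_norm.
set H := eta * _ / _ in S4; rewrite S4 in S2.
have -> : eta * (ham v w)%:R / (32 * (d%:R * k%:R)) = H / 32.
  by rewrite /H; field; rewrite ?gt_eqF ?ltr0n.
have H0 : 0 <= H by rewrite -S4; apply: sumr_ge0.
(* The L1 distance is at least A and at least A + H/16 - 2 A; the average of the two bounds is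
   H/32. *)
have : A * \sum_p odds eta w p <= A * 2 by rewrite ler_wpM2l.
have : 1 / 16 * H <= Zv * H by rewrite ler_wpM2r.
have S5 : 0 <= \sum_p `|Zv * odds eta v p - Zw * odds eta w p| by apply: sumr_ge0.
lra.
Qed.

(** * Lower bounds *)

Lemma hard_pair (R : realType) (d k n m : nat) (alpha eta : R)
    (A : algorithm R {ffun 'I_d -> 'I_k.+1} (fdist R {ffun 'I_d -> 'I_k.+1}) n m) :
  (0 < d)%N -> (0 < k)%N -> 0 < alpha -> 2 ^+ 12 * alpha <= eta <= 1 ->
  (forall D, is_product D -> 2 / 3 <= success A D (fun Q => dTV Q D <= alpha)) ->
  exists (P Q : fdist R {ffun 'I_d -> 'I_k.+1}) (S : {set 'I_(size_out A)}),
    [/\ forall z, 0 < Q z,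
        \sum_z P z ^+ 2 / Q z <= expR (eta ^+ 2),
        2 / 3 <= Eprod (pw P) (fun x => Prob (run A x) S) &
        Eprod (pw Q) (fun x => Prob (run A x) S) <= (3 / 5) ^+ (d * k)].
Proof.
move=> d0 k0 a0 /andP[ea e1] sol.
have e0 : 0 <= eta by lra.
have eta_gt0 : 0 < eta by lra.
have e01 : 0 <= eta <= 1 by rewrite e0.
have dk0 : 0 < d%:R * k%:R :> R by rewrite mulr_gt0 ?ltr0n.
have L1 (P Q : fdist R {ffun 'I_d -> 'I_k.+1}) :
    dTV P Q <= alpha -> \sum_z `|P z - Q z| <= 2 * alpha.
  by rewrite /dTV ler_pdivrMl.
have [D hD] := odds_fdist d k e0.
pose G v : {set 'I_(size_out A)} := [set o | `[< dTV (out o) (D v) <= alpha >]]%SET.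
pose q v := Eprod (pw (D (origin d k))) (fun x => Prob (run A x) (G v)).
(* Any member [w] for which [o] is correct serves as the centre of a Hamming ball containing all the
   others. *)
have cnt (o : 'I_(size_out A)) : (#|[pred v | o \in G v]|)%:R <= (6 / 5) ^+ (d * k) :> R.
  case: (pickP [pred v | o \in G v]) => [w /=|no]; last first.
    by rewrite eq_card0 // exprn_ge0 //; lra.
  rewrite inE => /asboolP hw.
  have -> : (d * k)%N = #|{: 'I_d * 'I_k}| by rewrite card_prod !card_ord.
  apply: le_trans (hamming_ball R w); rewrite ler_nat; apply: subset_leq_card.
  apply/fintype.subsetP => v; rewrite unfold_in /= /G finset.inE.
  move=> /asboolP hv; rewrite unfold_in /=.
  have sep := odds_L1 d0 k0 e01 (hD v).2 (hD w).2.
  have tri : \sum_z `|D v z - D w z| <= 4 * alpha.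
    have : \sum_z `|D v z - D w z| <= \sum_z `|out o z - D v z| + \sum_z `|out o z - D w z|.
      rewrite -big_split /=; apply: ler_sum => z _.
      by rewrite [`|out o z - D v z|]distrC; exact: ler_distD.
    move=> h; apply: le_trans h _; have -> : 4 * alpha = 2 * alpha + 2 * alpha by ring.
    by apply: lerD; exact: L1.
  rewrite card_prod !card_ord -(ler_nat R) !natrM.
  (* The constant 2^12 gives 4 alpha <= eta / 1024; with the 32 of [odds_L1] this yields the radius
     d k / 32 of [hamming_ball]. *)
  have : eta * (ham v w)%:R / (32 * (d%:R * k%:R)) <= eta / 1024 by lra.
  rewrite ler_pdivrMr; last by rewrite mulr_gt0.
  have -> : eta / 1024 * (32 * (d%:R * k%:R)) = eta * (d%:R * k%:R / 32) by field.
  by rewrite ler_pM2l //; lra.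
have total : \sum_v q v <= (6 / 5) ^+ (d * k).
  rewrite /q -Eprod_exchange.
  have p1 : \sum_(u : {ffun 'I_m -> {ffun 'I_d -> 'I_k.+1}}) pw (D (origin d k)) u = 1.
    by rewrite sum_pw fdist_sum expr1n.
  rewrite -[leRHS](Eprod_cst n _ p1); apply: Eprod_le.
    by move=> u; apply: pw_ge0 => z; exact: fdist_ge0.
  move=> x; rewrite /Prob.
  under eq_bigr => v _ do rewrite big_mkcond /=.
  rewrite exchange_big /=.
  apply: (@le_trans _ _ (\sum_o run A x o * (6 / 5) ^+ (d * k))); last first.
    by rewrite -mulr_suml fdist_sum mul1r.
  apply: ler_sum => o _; rewrite -big_mkcond /= sumr_const -[leLHS]mulr_natr.
  by apply: ler_wpM2l; [exact: fdist_ge0 | exact: cnt].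
(* Averaging over the 2^(d k) members, with 2 * (3/5) = 6/5. *)
have [v hv] : exists v, q v <= (3 / 5) ^+ (d * k).
  apply: contrapT => /forallNP no.
  have : \sum_(v : {ffun 'I_d * 'I_k -> bool}) (3 / 5) ^+ (d * k) < \sum_v q v.
    apply: ltr_sum; first by apply/hasP; exists (origin d k); rewrite ?mem_index_enum.
    by move=> v _; rewrite ltNge; apply/negP; exact: no.
  rewrite sumr_const card_ffun card_bool card_prod !card_ord -[X in X < _]mulr_natl.
  rewrite natrX -exprMn (_ : 2 * (3 / 5) = 6 / 5); last by field.
  by rewrite ltNge total.
exists (D v), (D (origin d k)), (G v); split => //.
- move=> z; rewrite (hD _).2; apply: prodr_gt0 => i _.
  by rewrite divr_gt0 ?odds_weight_gt0 ?odds_total_gt0.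
- exact: (odds_chi2 d0 k0 e0 (hD v).2 (hD _).2).
- exact: (sol (D v) (hD v).1).
Qed.

Lemma pw_fdist_ge0 (R : realType) (T : finType) (n : nat) (P : fdist R T)
  (u : {ffun 'I_n -> T}) : 0 <= pw P u.
Proof. by apply: pw_ge0 => t; exact: fdist_ge0. Qed.

Lemma sum_pw_fdist (R : realType) (T : finType) (n : nat) (P : fdist R T) :
  \sum_(u : {ffun 'I_n -> T}) pw P u = 1.
Proof. by rewrite sum_pw fdist_sum expr1n. Qed.

Lemma expR_le_of_mul (R : realType) (x y : R) : x < 1 -> 1 <= y * (1 - x) -> expR x <= y.
Proof.
move=> x1 xy; rewrite -[leLHS]invrK -expRN.
apply: (@le_trans _ _ (1 - x)^-1).
  rewrite lef_pV2 ?posrE ?expR_gt0 ?subr_gt0 //; exact: expR_ge1Dx.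
by rewrite -[leLHS]mul1r ler_pdivrMr // subr_gt0.
Qed.

(** By [dp_hybrid], (1 + t K)^n must be at least (2/3)(5/3)^N >= (10/9)^N >= e^(N/10), where K =
    e^eps - 1 <= 2 eps. *)
Lemma privacy_lower (R : realType) (Z : finType) (O : Type) (n m N : nat)
    (A : algorithm R Z O n m) (P Q : fdist R Z) (S : {set 'I_(size_out A)}) (eps t : R) :
  user_DP A eps 0 -> 0 < eps <= 1 / 2 -> (0 < N)%N ->
  2 / 3 <= Eprod (pw P) (fun x => Prob (run A x) S) ->
  Eprod (pw Q) (fun x => Prob (run A x) S) <= (3 / 5) ^+ N ->
  \sum_(u : {ffun 'I_m -> Z}) `|pw P u - pw Q u| <= 2 * t ->
  N%:R / 20 <= n%:R * t * eps.
Proof.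
move=> dp /andP[e0 e1] N0 lo hi PQ.
have t0 : 0 <= t.
  have : 0 <= 2 * t by apply: le_trans PQ; apply: sumr_ge0.
  lra.
pose K := expR eps - 1.
have K0 : 0 <= K by rewrite subr_ge0; apply: le_trans (expR_ge1Dx _); lra.
have K2 : K <= 2 * eps by have := expR_quad e1; rewrite /K; nra.
have hyb : Eprod (pw P) (fun x => Prob (run A x) S) <=
    (1 + t * K) ^+ n * Eprod (pw Q) (fun x => Prob (run A x) S).
  apply: dp_hybrid => //.
  - exact: pw_fdist_ge0.
  - exact: sum_pw_fdist.
  - exact: pw_fdist_ge0.
  - exact: sum_pw_fdist.
  - by move=> x; exact: Prob_ge0.
  - by move=> x x' /(dp x x') /(_ S); rewrite addr0 /K addrC subrK.
have e2 : (1 + t * K) ^+ n <= expR (n%:R * (t * K)).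
  rewrite expRM_natl lerXn2r ?nnegrE ?expR_ge0 ?addr_ge0 ?mulr_ge0 //.
  exact: expR_ge1Dx.
have num : (10 / 9) ^+ N <= 2 / 3 * (5 / 3) ^+ N :> R.
  case: N N0 {hi} => // N _; elim: N => [|N IH]; first by lra.
  rewrite exprS [in leRHS]exprS [leRHS]mulrCA.
  by apply: ler_pM => //; rewrite ?exprn_ge0 //; lra.
have e3 : expR (N%:R / 10) <= (10 / 9) ^+ N :> R.
  rewrite expRM_natl lerXn2r ?nnegrE ?expR_ge0 //; try lra.
  by apply: expR_le_of_mul; lra.
have : expR (N%:R / 10) <= expR (n%:R * (t * K)).
  apply: le_trans e3 _; apply: le_trans num _.
  have -> : (5 / 3) ^+ N = ((3 / 5) ^+ N)^-1 :> R by rewrite -exprVn; congr (_ ^+ _); field.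
  rewrite ler_pdivrMr; last by rewrite exprn_gt0 //; lra.
  apply: le_trans lo _; apply: le_trans hyb _; apply: ler_pM => //.
    by rewrite exprn_ge0 // addr_ge0 // mulr_ge0.
  by apply: Eprod_ge0 => x; [exact: pw_fdist_ge0 | exact: Prob_ge0].
rewrite ler_expR.
have : n%:R * (t * K) <= n%:R * (t * (2 * eps)) by rewrite !ler_wpM2l.
lra.
Qed.

Lemma sampling_lower (R : realType) (Z : finType) (O : Type) (n m N : nat)
    (A : algorithm R Z O n m) (P Q : fdist R Z) (S : {set 'I_(size_out A)}) (eta : R) :
  (forall z, 0 < Q z) -> (0 < N)%N ->
  \sum_z P z ^+ 2 / Q z <= expR (eta ^+ 2) ->
  2 / 3 <= Eprod (pw P) (fun x => Prob (run A x) S) ->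
  Eprod (pw Q) (fun x => Prob (run A x) S) <= (3 / 5) ^+ N ->
  N%:R / 400 <= n%:R * m%:R * eta ^+ 2.
Proof.
move=> Q0 N0 chi lo hi.
have chi' : \sum_(x : database Z n m) pw (pw P) x ^+ 2 / pw (pw Q) x <=
    1 + (expR (n%:R * m%:R * eta ^+ 2) - 1).
  rewrite addrC subrK chi2_pw chi2_pw -exprM -natrM [(n * m)%N]mulnC expRM_natl.
  rewrite lerXn2r ?nnegrE ?expR_ge0 //.
  by apply: sumr_ge0 => z _; rewrite divr_ge0 ?sqr_ge0 // ltW.
set B := _ - 1 in chi'.
set th : R := (3 / 5) ^+ N in hi.
have th0 : 0 < th by rewrite exprn_gt0 //; lra.
have th1 : th <= 3 / 5 by rewrite /th -[leRHS]expr1; apply: ler_wiXn2l => //; lra.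
(* The gap 2/3 - 3/5 equals 1/15, and the weight 15 th makes the last term of [chi2_event] at most
   half of it; the other half forces B th >= 1/225. *)
have l0 : 0 < 15 * th by lra.
have pwQ0 (x : database Z n m) : 0 < pw (pw Q) x.
  by apply: prodr_gt0 => i _; apply: prodr_gt0 => j _.
have s1 (D : fdist R Z) : \sum_(x : database Z n m) pw (pw D) x = 1.
  by rewrite sum_pw sum_pw_fdist expr1n.
have g01 (x : database Z n m) : 0 <= Prob (run A x) S <= 1.
  by rewrite Prob_ge0 Prob_le1.
have := chi2_event pwQ0 (s1 P) (s1 Q) l0 g01 chi'.
rewrite -/(Eprod (pw P) (fun x => Prob (run A x) S)) -/(Eprod (pw Q) (fun x => Prob (run A x) S)).
set p := Eprod (pw P) _ in lo *; set q := Eprod (pw Q) _ in hi * => ev.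
have qt : q / (15 * th) <= 1 / 15.
  by rewrite ler_pdivrMr //; lra.
have Bth : 1 / 225 <= B * th by lra.
have Bb : (5 / 3) ^+ N / 225 <= B.
  have -> : (5 / 3) ^+ N / 225 = 1 / 225 / th.
    have i53 : (3 / 5)^-1 = 5 / 3 :> R by field.
    by rewrite /th -exprVn i53; ring.
  by rewrite ler_pdivrMr.
(* [c] is the value of 1 - 1/225 + (5/3)^N / 225 at N = 1; it exceeds e^(1/400). *)
have [c hc] : exists c : R, c = 1 + 2 / 675 by eexists.
have c0 : 0 <= c by rewrite hc; lra.
have num : c ^+ N <= 1 - 1 / 225 + (5 / 3) ^+ N / 225.
  elim: (N) => [|M IH]; first by rewrite !expr0; lra.
  rewrite !exprS; have b1 : 1 <= (5 / 3) ^+ M :> R by rewrite exprn_ege1 //; lra.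
  have : c * c ^+ M <= c * (1 - 1 / 225 + (5 / 3) ^+ M / 225) by rewrite ler_wpM2l.
  rewrite hc; lra.
have : expR (N%:R / 400) <= expR (n%:R * m%:R * eta ^+ 2).
  apply: (@le_trans _ _ (c ^+ N)).
    rewrite expRM_natl lerXn2r ?nnegrE ?expR_ge0 //.
    by apply: expR_le_of_mul; rewrite ?hc; lra.
  by move: Bb num; rewrite /B; lra.
by rewrite ler_expR.
Qed.

Lemma L1_le2 (R : realType) (T : finType) (P Q : T -> R) :
  (forall t, 0 <= P t) -> \sum_t P t = 1 -> (forall t, 0 <= Q t) -> \sum_t Q t = 1 ->
  \sum_t `|P t - Q t| <= 2.
Proof.
move=> P0 P1 Q0 Q1; have -> : 2 = \sum_t (P t + Q t) by rewrite big_split /= P1 Q1.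
apply: ler_sum => t _; apply: le_trans (ler_normB _ _) _.
by rewrite !ger0_norm.
Qed.

(** For y = eta sqrt m <= 1/2, tensorisation gives chi-square at most e^(y^2) - 1 <= (4 y)^2. For
    larger y the right side exceeds the trivial bound 2. *)
Lemma user_L1 (R : realType) (Z : finType) (m : nat) (P Q : fdist R Z) (eta : R) :
  (0 < m)%N -> (forall z, 0 < Q z) -> 0 < eta ->
  \sum_z P z ^+ 2 / Q z <= expR (eta ^+ 2) ->
  \sum_(u : {ffun 'I_m -> Z}) `|pw P u - pw Q u| <= 2 * (2 * eta * Num.sqrt m%:R).
Proof.
move=> m0 Q0 e0 chi.
set r := Num.sqrt m%:R.
have rr : r ^+ 2 = m%:R by rewrite sqr_sqrtr.
have r0 : 0 < r by rewrite sqrtr_gt0 ltr0n.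
have er0 : 0 < eta * r by exact: mulr_gt0.
case: (lerP (2 * (2 * eta * r)) 2) => h; last first.
  apply: le_trans (ltW h); apply: L1_le2; rewrite ?sum_pw_fdist //; exact: pw_fdist_ge0.
apply: (@chi2_L1 _ _ _ _ (2 * (2 * eta * r))); rewrite ?sum_pw_fdist //; last 2 first.
- by move: er0; lra.
- rewrite chi2_pw; apply: (@le_trans _ _ (expR (eta ^+ 2) ^+ m)).
    rewrite lerXn2r ?nnegrE ?expR_ge0 //.
    by apply: sumr_ge0 => z _; rewrite divr_ge0 ?sqr_ge0 // ltW.
  rewrite -expRM_natl -rr -exprMn mulrC.
  set y := eta * r in er0 *.
  have y2 : y <= 1 / 2 by rewrite /y; lra.
  have y4 : y ^+ 2 <= 1 / 4 by nra.
  have := @expR_quad R (y ^+ 2); rewrite (_ : 2 * (2 * eta * r) = 4 * y); last by rewrite /y; ring.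
  move=> /(_ _)/le_trans; apply; first by lra.
  nra.
by move=> u; apply: prodr_gt0 => j _.
Qed.

(** The first bound takes eta = 1 with the trivial total variation bound 1; the other two take the
    smallest eta that [hard_pair] admits. *)
Lemma PD_lower (R : realType) (d k m n : nat) (alpha eps : R) :
  (0 < d)%N -> (0 < k)%N -> (0 < m)%N -> 0 < alpha -> 2 ^+ 12 * alpha <= 1 ->
  0 < eps <= 1 / 2 -> user_solvable (PD k.+1 d alpha) m eps 0 n ->
  [/\ (d * k)%:R / 20 <= n%:R * eps,
      (d * k)%:R / 20 <= n%:R * (2 * (2 ^+ 12 * alpha) * Num.sqrt m%:R) * eps &
      (d * k)%:R / 400 <= n%:R * m%:R * (2 ^+ 12 * alpha) ^+ 2].
Proof.
move=> d0 k0 m0 a0 a1 e01 [A [dp sol]].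
have N0 : (0 < d * k)%N by rewrite muln_gt0 d0.
have eta0 : 0 < 2 ^+ 12 * alpha by rewrite mulr_gt0 // exprn_gt0.
have [|P [Q [S [Q0 chi lo hi]]]] := hard_pair (eta := 2 ^+ 12 * alpha) d0 k0 a0 _ sol.
  by rewrite lexx.
have [|P' [Q' [S' [_ _ lo' hi']]]] := hard_pair (eta := 1) d0 k0 a0 _ sol.
  by rewrite a1 lexx.
split.
- rewrite -[n%:R]mulr1; apply: (privacy_lower dp e01 N0 lo' hi'); rewrite mulr1.
  apply: L1_le2; rewrite ?sum_pw_fdist //; exact: pw_fdist_ge0.
- apply: (privacy_lower dp e01 N0 lo hi); exact: user_L1.
- exact: (sampling_lower Q0 N0 chi lo hi).
Qed.

Lemma lower_arith (R : realType) (kd N n alpha eps r m : R) :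
  0 <= n -> 0 < alpha -> 0 < eps -> 0 < r -> 0 < m -> kd <= 2 * N ->
  N / 20 <= n * eps -> N / 20 <= n * (2 * (2 ^+ 12 * alpha) * r) * eps ->
  N / 400 <= n * m * (2 ^+ 12 * alpha) ^+ 2 ->
  kd / eps + kd / (alpha * eps * r) + kd / (alpha ^+ 2 * m) <= 10 ^+ 11 * n.
Proof.
move=> n0 a0 e0 r0 m0 kN h1 h2 h3.
have b1 : kd / eps <= 40 * n by rewrite ler_pdivrMr //; lra.
have b2 : kd / (alpha * eps * r) <= 40 * (2 * 2 ^+ 12) * n.
  by rewrite ler_pdivrMr ?mulr_gt0 //; lra.
have b3 : kd / (alpha ^+ 2 * m) <= 800 * (2 ^+ 12) ^+ 2 * n.
  by rewrite ler_pdivrMr ?mulr_gt0 //; lra.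
apply: le_trans (lerD (lerD b1 b2) b3) _.
rewrite -!mulrDl ler_wpM2r //; lra.
Qed.

Theorem theoremE9 (R : realType) :
  exists (alpha0 eps0 C : R) (p : nat),
    [/\ 0 < alpha0, 0 < eps0, 0 < C &
      forall (k d m : nat) (alpha eps : R),
        (2 <= k)%N -> (1 <= d)%N -> (1 <= m)%N ->
        0 < alpha <= alpha0 -> 0 < eps <= eps0 ->
        exists n : nat,
          is_user_complexity (PD k d alpha) m eps 0 n /\
          theta_tilde_with C p (k%:R * d%:R / alpha) n%:R
            (k%:R * d%:R / eps
             + k%:R * d%:R / (alpha * eps * Num.sqrt m%:R)
             + k%:R * d%:R / (alpha ^+ 2 * m%:R))].
Proof.
(* The threshold on alpha keeps eta = 2^12 alpha at most 1, the one on eps serves [privacy_lower],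
   and the exponent 3 comes from [sample_size_bound]. The lower bound dictates 10^11, which covers
   the 10^7 of the upper bound. *)
exists ((2 ^+ 12)^-1), (1 / 2), (10 ^+ 11), 3%N; split; rewrite ?invr_gt0 ?exprn_gt0 ?divr_gt0 //.
move=> [//|k] d m alpha eps k1 d1 m1 /andP[a0 a1] /andP[e0 e1].
have k0 : (0 < k)%N by [].
have a4096 : 2 ^+ 12 * alpha <= 1 by rewrite -ler_pdivlMl ?mulr1 // exprn_gt0.
have aa1 : alpha <= 1 by lra.
have ee1 : eps <= 1 by lra.
have [||n0 sol0 up0] := @PD_upper R k.+1 d m alpha eps isT d1 m1.
- by rewrite a0.
- by rewrite e0.
have ex : exists n, `[< user_solvable (PD k.+1 d alpha) m eps 0 n >].
  by exists n0; exact/asboolP.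
have [n /asboolP sol minn] := ex_minnP ex.
have nn0 : (n <= n0)%N by apply: minn; exact/asboolP.
exists n; split.
  by split=> // n' sol'; apply: minn; exact/asboolP.
set y := _ / eps + _ + _ in up0 *.
set L := 1 + ln _ in up0 *.
have L1 : 1 <= L.
  rewrite /L lerDl ln_ge0 // ler_pdivlMr // mul1r.
  by apply: le_trans aa1 _; rewrite -natrM ler1n muln_gt0.
have L0 : 0 < L by exact: lt_le_trans L1.
have L3 : 1 <= L ^+ 3 by rewrite exprn_ege1.
have L30 : 0 < L ^+ 3 by exact: lt_le_trans L3.
have r0 : 0 < Num.sqrt m%:R :> R by rewrite sqrtr_gt0 ltr0n.
have y0 : 0 <= y.
  by rewrite /y !addr_ge0 // !mulr_ge0 ?invr_ge0 ?mulr_ge0 ?sqr_ge0 ?(ltW a0) ?(ltW e0) ?(ltW r0).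
apply/andP; split; last first.
  apply: (@le_trans _ _ n0%:R); first by rewrite ler_nat.
  apply: le_trans up0 _; rewrite ler_wpM2r // ler_wpM2r ?ltW //; lra.
have lowy : y <= 10 ^+ 11 * n%:R.
  have [|h1 h2 h3] := PD_lower d1 k0 m1 a0 a4096 _ sol; first by rewrite e0.
  apply: (lower_arith (ler0n _ n) a0 e0 r0 _ _ h1 h2 h3); first by rewrite ltr0n.
  (* Over k + 1 symbols the hard family has d k cells, and k + 1 <= 2 k. *)
  rewrite -!natrM ler_nat [leqLHS]mulnC [leqRHS]mulnCA leq_mul2l.
  by rewrite mul2n -addnn -addn1 leq_add2l k0 orbT.
rewrite ler_pdivrMr ?mulr_gt0 ?exprn_gt0 //.
apply: le_trans lowy _; rewrite mulrC ler_wpM2l // ler_peMr // exprn_ge0 //.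
Qed.
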